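(* Let $d\ge1$, $\sigma>0$, let $P$ be a distribution on $\mathbb{R}^d$, and let $S\sim P$, $Y=S+Z$ with $Z\sim\mathcal{N}_\sigma$ independent of $S$. If $I_{\chi^2}(S;Y)=\infty$, then for any $0<\tau<\sigma$, as $n\to\infty$, $$\mathbb{E}_{P^{\otimes n}}\,\mathsf{W}_2^2\big(\hat P_{S^n}\ast\mathcal{N}_\tau,\;P\ast\mathcal{N}_\tau\big)=\omega\left(\frac1n\right).$$
   Context: For $s>0$, $\mathcal{N}_s=\mathcal{N}(0,s^2\mathrm{I}_d)$; $S^n=(S_1,\dots,S_n)\sim P^{\otimes n}$; $\hat P_{S^n}=\frac1n\sum_{i=1}^n\delta_{S_i}$; $\ast$ is convolution of measures. $\mathsf{W}_2^2(\mu,\nu)=\inf\mathbb{E}\|X-Y\|^2$ over all couplings of $X\sim\mu$, $Y\sim\nu$. $\chi^2(\mu\|\nu)=\int\big(\frac{d\mu}{d\nu}-1\big)^2d\nu$, and $I_{\chi^2}(S;Y)=\chi^2(P_{S,Y}\|P_S\otimes P_Y)$, where $P_{S,Y}$ is the joint law of $(S,Y)$ and $P_S,P_Y$ its marginals. $a_n=\omega(1/n)$ means $n\,a_n\to\infty$ as $n\to\infty$. *)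

(* Defs.v *)
(* R^d is [d.-tuple R] with the library's product sigma-algebra, which is the
   Borel sigma-algebra of R^d. *)
From HB Require Import structures.
From mathcomp Require Import all_boot all_order all_algebra.
From mathcomp Require Import all_classical all_reals all_analysis measurable_realfun.

Set Implicit Arguments.
Unset Strict Implicit.
Unset Printing Implicit Defensive.

Import Order.TTheory GRing.Theory Num.Theory.
Import numFieldNormedType.Exports.

Local Open Scope classical_set_scope.
Local Open Scope ring_scope.
Local Open Scope ereal_scope.
Local Open Scope charge_scope.

Section vectors.
Context {R : realType} {d : nat}.
Implicit Types x y : d.-tuple R.

Definition vadd x y : d.-tuple R := [tuple (tnth x i + tnth y i)%R | i < d].

Definition sqdist x y : R := (\sum_(i < d) (tnth x i - tnth y i) ^+ 2)%R.

Lemma measurable_vadd :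
  measurable_fun [set: d.-tuple R * d.-tuple R] (fun z => vadd z.1 z.2).
Proof.
apply/measurable_fun_tnthP => i.
have -> : (@tnth d R ^~ i \o fun z => vadd z.1 z.2) =
    (fun z : d.-tuple R * d.-tuple R => (tnth z.1 i + tnth z.2 i)%R).
  by apply/funext => z /=; rewrite tnth_mktuple.
apply: measurable_funD.
- by apply: measurableT_comp (measurable_tnth _) _.
- by apply: measurableT_comp (measurable_tnth _) _.
Qed.

End vectors.

Section iid.
Context {R : realType} {dT : measure_display} {T : measurableType dT}.

Definition tcons (n : nat) (z : T * n.-tuple T) : n.+1.-tuple T :=
  [tuple of z.1 :: z.2].

Lemma measurable_tcons n : measurable_fun [set: T * n.-tuple T] (@tcons n).
Proof. exact: measurable_cons. Qed.

HB.instance Definition _ n :=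
  isMeasurableFun.Build _ _ _ _ (@tcons n) (@measurable_tcons n).

(* The n-fold product measure: the image of P \x P^{(x) n} under (x, t) |-> x :: t *)
Fixpoint power_prob (P : probability T R) (n : nat) :
    probability (n.-tuple T) R :=
  if n is m.+1 then distribution (P \x power_prob P m) (@tcons m)
  else \d_([tuple] : 0.-tuple T).

(* The default [point] is never reached, since the indices satisfy i < n;
   for n = 0 this is the zero measure. *)
Definition empirical n (s : n.-tuple T) : {measure set T -> \bar R} :=
  mscale ((n%:R^-1)%:nng)%R (msum (fun i => \d_(nth point s i)) n).

End iid.

(* [normal_prob m s] (mean m, standard deviation s), which the library puts on
   [measurableTypeR R], as a probability on R itself: the two types have convertible
   carriers and measurable sets but different displays. *)
Section normal_on_R.
Context {R : realType}.
Variables m s : R.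

Definition normalR : set R -> \bar R := normal_prob m s.

Let normalR0 : normalR set0 = 0.
Proof. exact: (measure0 (normal_prob m s)). Qed.

Let normalR_ge0 A : 0 <= normalR A.
Proof. exact: (measure_ge0 (normal_prob m s)). Qed.

Let normalR_sigma_additive : semi_sigma_additive normalR.
Proof. exact: (@measure_semi_sigma_additive _ _ _ (normal_prob m s)). Qed.

HB.instance Definition _ := isMeasure.Build _ _ _ normalR
  normalR0 normalR_ge0 normalR_sigma_additive.

Let normalR_setT : normalR [set: R] = 1.
Proof. exact: (probability_setT (normal_prob m s)). Qed.

HB.instance Definition _ :=
  Measure_isProbability.Build _ _ _ normalR normalR_setT.

End normal_on_R.

(* N(0, s^2 I_d), the law of d independent N(0, s^2) coordinates. *)
Definition gaussian {R : realType} (d : nat) (s : R) : probability (d.-tuple R) R :=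
  power_prob (normalR 0%R s) d.

Section convol.
Context {R : realType} {d : nat}.
Variables (mu : {measure set (d.-tuple R) -> \bar R})
  (nu : {sigma_finite_measure set (d.-tuple R) -> \bar R}).

Definition convolution : set (d.-tuple R) -> \bar R :=
  pushforward (mu \x nu) (fun z => vadd z.1 z.2).

Let mpre A : measurable A ->
  measurable ((fun z : d.-tuple R * d.-tuple R => vadd z.1 z.2) @^-1` A).
Proof. by move=> mA; rewrite -[X in measurable X]setTI; exact: measurable_vadd. Qed.

Let conv0 : convolution set0 = 0.
Proof. by rewrite /convolution /pushforward preimage_set0 measure0. Qed.

Let conv_ge0 A : 0 <= convolution A.
Proof. exact: (measure_ge0 (mu \x nu)). Qed.

Let conv_sigma_additive : semi_sigma_additive convolution.
Proof.
move=> F mF tF mUF; rewrite /convolution /pushforward preimage_bigcup.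
apply: (@measure_semi_sigma_additive _ _ _ (mu \x nu)).
- by move=> n; exact: mpre.
- apply/trivIsetP => i j _ _ ij; rewrite -preimage_setI.
  by move/trivIsetP : tF => /(_ _ _ _ _ ij) ->//; rewrite preimage_set0.
- by rewrite -preimage_bigcup; exact: mpre.
Qed.

HB.instance Definition _ := isMeasure.Build _ _ _ convolution
  conv0 conv_ge0 conv_sigma_additive.

End convol.

Definition couplings {R : realType} {dT : measure_display}
    {T : measurableType dT} (mu nu : {measure set T -> \bar R}) :
    set (probability (T * T)%type R) :=
  [set pi | forall A, measurable A ->
     pi (fst @^-1` A) = mu A /\ pi (snd @^-1` A) = nu A].

(* The infimum is taken in [0, +oo]: it is +oo when every coupling has infinite cost. *)
Definition W2sq {R : realType} {d : nat}
    (mu nu : {measure set (d.-tuple R) -> \bar R}) : \bar R :=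
  ereal_inf [set \int[pi]_z (sqdist z.1 z.2)%:E | pi in couplings mu nu].

(* chi^2(mu || nu), equal to +oo when mu is not absolutely continuous w.r.t. nu. *)
Definition chi2_div {R : realType} {dT : measure_display}
    {T : measurableType dT} (mu nu : probability T R) : \bar R :=
  if `[< mu `<< nu >] then
    \int[nu]_x (('d (charge_of_finite_measure mu) '/d nu) x - 1) ^+ 2
  else +oo.

Section random_variables.
Context {R : realType} {dO : measure_display} {Omega : measurableType dO}.
Variable Pr : probability Omega R.

Definition has_law {dT : measure_display} {T : measurableType dT}
    (X : {RV Pr >-> T}) (mu : probability T R) : Prop :=
  forall A, measurable A -> distribution Pr X A = mu A.

Context {d1 d2 : measure_display} {T1 : measurableType d1} {T2 : measurableType d2}.

Definition independent_RV (X : {RV Pr >-> T1}) (Y : {RV Pr >-> T2}) : Prop :=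
  forall A B, measurable A -> measurable B ->
    Pr (X @^-1` A `&` Y @^-1` B) = Pr (X @^-1` A) * Pr (Y @^-1` B).

Definition RV_pair (X : {RV Pr >-> T1}) (Y : {RV Pr >-> T2}) : Omega -> T1 * T2 :=
  fun w => (X w, Y w).

Lemma measurable_RV_pair (X : {RV Pr >-> T1}) (Y : {RV Pr >-> T2}) :
  measurable_fun [set: Omega] (RV_pair X Y).
Proof. exact: measurable_fun_pair. Qed.

HB.instance Definition _ X Y :=
  isMeasurableFun.Build _ _ _ _ (RV_pair X Y) (measurable_RV_pair X Y).

Definition chi2_info (X : {RV Pr >-> T1}) (Y : {RV Pr >-> T2}) : \bar R :=
  chi2_div (distribution Pr (RV_pair X Y))
           (distribution Pr X \x distribution Pr Y).

End random_variables.
Arguments has_law {R dO Omega} Pr {dT T} X mu.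
Arguments independent_RV {R dO Omega} Pr {d1 d2 T1 T2} X Y.
Arguments chi2_info {R dO Omega} Pr {d1 d2 T1 T2} X Y.

(* a_n = omega(1/n); a_n may be +oo, e.g. when P has no second moment. *)
Definition is_omega_inv {R : realType} (a : nat -> \bar R) : Prop :=
  n%:R%:E * a n @[n --> \oo] --> +oo.

(* Main.v *)
Require Import Defs.
From HB Require Import structures.
From mathcomp Require Import all_boot all_order all_algebra.
From mathcomp Require Import all_classical all_reals all_analysis measurable_realfun.
From mathcomp Require Import ring lra.

(** Smoothing by N(0, s^2 I) turns a transport cost into an f-divergence: if
    sigma^2 = tau^2 + s^2, then for a coupling of mu * N_tau and nu * N_tau
    the two measures become mu * N_sigma and nu * N_sigma after adding the same
    independent N_s noise, and two Gaussians N(x, s^2), N(x', s^2) have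
    Bhattacharyya affinity exp(- |x - x'|^2 / (8 s^2)).  Averaging this over
    the coupling bounds W_2^2 from below by a divergence of the smoothed
    measures.  The averaging is done through the variational form of the
    affinity: for every function t > 0, the sum of the integral of t under the
    first Gaussian and of 1/t under the second is at least
    2 - |x - x'|^2 / (4 s^2), by AM-GM ([gaussian_affinity]); this is linear in
    the two laws, hence survives integration over the coupling
    ([W2sq_ge_affinity]).

    All densities are taken with respect to gamma = N(0, sigma^2 I):
    N(x, sigma^2 I) has density k(x, y) = exp ((<x, y> - |x|^2 / 2) / sigma^2)
    by the Cameron-Martin formula, so that P * N_sigma has density
    f(y) = E k(S, y) and the smoothed empirical measure has density f_n(y), the
    mean of the k(S_i, y).  The choice t = 2 f / (f_n + f) then gives
      W_2^2 >= 4 s^2 * int (f_n - f)^2 / (2 (f_n + f)) dgamma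
    ([W2sq_ge_triangular], [W2sq_empirical_ge]).

    For fixed y the numbers k(S_i, y) are i.i.d. and lie between 0 and
    C(y) = exp (|y|^2 / (2 sigma^2)).  The tangent bound
    1 / (f_n + f) >= 1 / (2 f) - (f_n - f) / (4 f^2) and the second and third
    moments of a sum of centered i.i.d. variables give, with v the variance of
    k(S, y),
      n E [(f_n - f)^2 / (f_n + f)] >= v / (2 f) * (1 - C / (2 f n))
    ([sample_mean_triangular_ge]).  The positive part of the right-hand side is
    nondecreasing in n and converges to v / (2 f), so by monotone convergence
    the liminf of n E W_2^2 is at least s^2 * int v / f dgamma
    ([scaled_risk_ge], [cvg_integral_risk_lower]).  This last integral is
    exactly I_chi2(S; Y) ([chi2_info_gaussian]), which is infinite. *)

Set Implicit Arguments.
Unset Strict Implicit.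
Unset Printing Implicit Defensive.

Import Order.TTheory GRing.Theory Num.Theory.
Import numFieldNormedType.Exports.

Local Open Scope classical_set_scope.
Local Open Scope ring_scope.
Local Open Scope ereal_scope.
Local Open Scope charge_scope.

(** * Integration *)

Section integration.
Import HBNNSimple.
Context {R : realType}.

(** The integral of a nonnegative function is a supremum over the simple functions
    below it, so it is monotone without measurability of either side; this
    matters because s |-> W2sq (...) is not known to be measurable. *)
Lemma ge0_le_integral_lower d (T : measurableType d)
    (mu : {measure set T -> \bar R}) (f g : T -> \bar R) :
    (forall x, 0 <= f x) -> (forall x, f x <= g x) ->
  \int[mu]_x f x <= \int[mu]_x g x.
Proof.
move=> f0 fg.
have g0 x : 0 <= g x by exact: le_trans (fg x).
rewrite !ge0_integralTE//; apply: ereal_sup_le => _ [h hf <-].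
by exists h => // x; exact: le_trans (fg x).
Qed.

Lemma le_integral_nng d (T : measurableType d)
    (mu : {measure set T -> \bar R}) (f g : T -> \bar R) :
    (forall x, 0 <= g x) -> (forall x, f x <= g x) ->
  \int[mu]_x f x <= \int[mu]_x g x.
Proof.
move=> g0 fg; rewrite integralE.
apply: (@le_trans _ _ (\int[mu]_x (f^\+) x)).
  by rewrite -[leRHS]sube0 leeB// integral_ge0.
apply: ge0_le_integral_lower => x; first exact: funepos_ge0.
by rewrite funeposE ge_max fg g0.
Qed.

Lemma integral_power_probS d (T : measurableType d) (P : probability T R) n
    (h : n.+1.-tuple T -> \bar R) :
    measurable_fun setT h -> (forall x, 0 <= h x) ->
  \int[power_prob P n.+1]_t h t =
  \int[P]_x \int[power_prob P n]_t h (tcons (x, t)).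
Proof.
move=> mh h0.
rewrite /= ge0_integral_distribution//.
rewrite fubini_tonelli1//.
- exact: measurableT_comp mh (@measurable_tcons _ _ _).
- by move=> z /=.
Qed.

Lemma integral_power_prob0 d (T : measurableType d) (P : probability T R)
    (h : 0.-tuple T -> \bar R) :
  measurable_fun setT h ->
  \int[power_prob P 0]_t h t = h [tuple].
Proof. by move=> mh; rewrite /= integral_dirac// diracT mul1e. Qed.

Lemma integral_cst_prob d (T : measurableType d) (P : probability T R) (r : R) :
  \int[P]_x r%:E = r%:E.
Proof. by rewrite integral_cst// [X in _ * X]probability_setT mule1. Qed.

(** Inversion of positive functions is expR \o -%R \o ln, each of which is
    measurable. *)
Lemma measurable_fun_invr d (T : measurableType d) (f : T -> R) :
    measurable_fun setT f -> (forall x, 0 < f x)%R ->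
  measurable_fun setT (fun x => (f x)^-1)%R.
Proof.
move=> mf f0.
have -> : (fun x => (f x)^-1)%R = (fun x => expR (- ln (f x)))%R.
  by apply/funext => x; rewrite expRN lnK// posrE.
apply: measurableT_comp => //; apply: measurableT_comp => //.
exact: measurableT_comp.
Qed.

End integration.

Section normal.
Context {R : realType}.
Local Notation mu := (@lebesgue_measure R).

Lemma ge0_integral_normal_prob (s : R) (h : measurableTypeR R -> \bar R) :
    measurable_fun setT h -> (forall x, 0 <= h x) ->
  \int[normal_prob 0%R s]_x h x = \int[mu]_x (h x * (normal_pdf 0%R s x)%:E).
Proof.
move=> mh h0.
have dom := @normal_prob_dominates R 0%R s.
rewrite -(Radon_Nikodym_SigmaFinite.change_of_variables dom)//.
have mf := Radon_Nikodym_SigmaFinite.f_integrable dom.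
have mp : measurable_fun [set: measurableTypeR R] (fun x => (normal_pdf 0%R s x)%:E).
  by apply/measurable_EFinP; exact: measurable_normal_pdf.
apply: ae_eq_integral => //.
- by apply: emeasurable_funM => //; exact: measurable_int mf.
- exact: emeasurable_funM.
- apply: ae_eqe_mul2l.
  apply: integral_ae_eq => //.
  by move=> E _ mE; rewrite -Radon_Nikodym_SigmaFinite.f_integral.
Qed.

(** [normalR] and [normal_prob] live on two copies of the real line that differ
    only in their displays; the identity transports one integral to the other. *)
Lemma ge0_integral_normalR (s : R) (h : R -> \bar R) :
    measurable_fun setT h -> (forall x, 0 <= h x) ->
  \int[normalR 0%R s]_x h x = \int[mu]_x (h x * (normal_pdf 0%R s x)%:E).
Proof.
move=> mh h0; rewrite -ge0_integral_normal_prob//.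
pose idTR : measurableTypeR R -> R := idfun.
have mid : measurable_fun setT idTR by move=> _ A mA; rewrite setTI.
transitivity (\int[pushforward (normal_prob 0%R s) idTR]_x h x).
  exact: eq_measure_integral.
by rewrite ge0_integral_pushforward.
Qed.

(** Lebesgue measure and its image under the shift agree on half-open intervals. *)
Lemma ge0_integral_lebesgue_shift (a : R) (h : R -> \bar R) :
    measurable_fun setT h -> (forall x, 0 <= h x) ->
  \int[mu]_x h (a + x)%R = \int[mu]_x h x.
Proof.
move=> mh h0.
pose f : measurableTypeR R -> measurableTypeR R := fun x => (a + x)%R.
have mf : measurable_fun setT f by exact: measurable_funD.
have muf A : measurable A -> mu A = pushforward mu f A.
  move=> mA. 
  apply: lebesgue_measure_unique => //= _ [[b c] _ <-].
  rewrite /pushforward.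
  have -> : f @^-1` `]b, c]%classic = `](b - a)%R, (c - a)%R]%classic.
    by apply/seteqP; split => x /=; rewrite !in_itv/= /f ltrBlDl lerBrDl.
  rewrite /= !lebesgue_measure_itv/= !lte_fin ltrD2r.
  by case: ifP => // _; rewrite -!EFinD; congr EFin; ring.
rewrite [RHS](eq_measure_integral (pushforward mu f)); last by move=> A mA _; exact: muf.
rewrite ge0_integral_pushforward//.
Qed.

End normal.

(** * One-dimensional Gaussian shifts and convolutions *)

Section normal_shift.
Context {R : realType}.
Local Notation mu := (@lebesgue_measure R).

(** The density of N(a, s^2) with respect to N(0, s^2). *)
Definition shift_density1 (s a z : R) : R := expR ((a * z - a ^+ 2 / 2) / s ^+ 2)%R.

Lemma normal_pdf_shift (s a z : R) : (s != 0)%R ->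
  (normal_pdf 0 s (z - a) = shift_density1 s a z * normal_pdf 0 s z)%R.
Proof.
move=> s0; rewrite !normal_pdfE// /shift_density1 mulrCA; congr (_ * _)%R.
rewrite /normal_fun -expRD; congr expR.
by field.
Qed.

Lemma measurable_shift_density1 (s : R) :
  measurable_fun setT (fun x : R * R => shift_density1 s x.1 x.2).
Proof.
apply: measurableT_comp => //; apply: measurable_funM => //.
apply: measurable_funB; first exact: measurable_funM.
by apply: measurable_funM => //; exact: measurable_funX.
Qed.

(** The Cameron-Martin formula in dimension one. *)
Lemma ge0_integral_normalR_shift (s a : R) (h : R -> \bar R) : (s != 0)%R ->
    measurable_fun setT h -> (forall x, 0 <= h x) ->
  \int[normalR 0%R s]_z h (a + z)%R =
  \int[normalR 0%R s]_z (h z * (shift_density1 s a z)%:E).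
Proof.
move=> s0 mh h0.
have mk : measurable_fun setT (shift_density1 s a).
  exact: measurableT_comp (measurable_shift_density1 s) (measurable_pair1 a).
have mpdf : measurable_fun [set: R] (normal_pdf 0 s) by exact: measurable_normal_pdf.
rewrite !ge0_integral_normalR//; last 3 first.
- by apply: emeasurable_funM => //; exact/measurable_EFinP.
- by move=> x; rewrite mule_ge0// lee_fin expR_ge0.
- by apply: measurableT_comp mh _; exact: measurable_funD.
pose g x := h x * (normal_pdf 0 s (x - a))%:E.
transitivity (\int[mu]_x g (a + x)%R).
  by apply: eq_integral => x _; rewrite /g addrAC subrr add0r.
rewrite ge0_integral_lebesgue_shift.
- by apply: eq_integral => x _; rewrite /g normal_pdf_shift// EFinM muleA.
- apply: emeasurable_funM => //; apply/measurable_EFinP.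
  by apply: measurableT_comp mpdf _; exact: measurable_funB.
- by move=> x; rewrite mule_ge0// lee_fin normal_pdf_ge0.
Qed.

(** Completing the square in z: the joint density of (z, w) for z ~ N(0, t^2) and
    w ~ N(z, s^2) factors as the law N(0, u^2) of w times the posterior law of
    z given w, which is again normal. *)
Lemma normal_pdf_conv (t s u z w : R) : (0 < t)%R -> (0 < s)%R -> (0 < u)%R ->
    (t ^+ 2 + s ^+ 2 = u ^+ 2)%R ->
  (shift_density1 s z w * normal_pdf 0 t z * normal_pdf 0 s w =
   normal_pdf 0 u w * normal_pdf (w * t ^+ 2 / u ^+ 2) (t * s / u) z)%R.
Proof.
move=> t0 s0 u0 tsu.
have ne0 (x : R) : (0 < x -> x != 0)%R by move=> x0; rewrite gt_eqF.
rewrite !normal_pdfE ?ne0 ?divr_gt0 ?mulr_gt0//.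
have peak : (normal_peak t * normal_peak s = normal_peak u * normal_peak (t * s / u))%R.
  rewrite /normal_peak -!invfM; congr (_^-1)%R.
  rewrite -!sqrtrM ?mulrn_wge0 ?(mulr_ge0, sqr_ge0, pi_ge0) ?ltW//.
  by congr Num.sqrt; field; rewrite ne0.
rewrite /normal_fun /shift_density1.
set e1 := expR _; set e2 := expR _; set e3 := expR _; set e4 := expR _; set e5 := expR _.
have ee : (e1 * e2 * e3 = e4 * e5)%R.
  rewrite /e1 /e2 /e3 /e4 /e5 -!expRD; congr expR.
  have u2 : (t ^+ 2 + s ^+ 2 != 0)%R by rewrite tsu ne0// exprn_gt0.
  rewrite !exprMn !exprVn -tsu.
  by field; rewrite u2 !ne0.
transitivity ((normal_peak t * normal_peak s) * (e1 * e2 * e3))%R; first by ring.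
by rewrite peak ee; ring.
Qed.

(** N(0, t^2) * N(0, s^2) = N(0, t^2 + s^2): in [normal_pdf_conv] the posterior
    law of z integrates to 1. *)
Lemma ge0_integral_normalR_conv (t s u : R) (h : R -> \bar R) :
    (0 < t)%R -> (0 < s)%R -> (0 < u)%R -> (t ^+ 2 + s ^+ 2 = u ^+ 2)%R ->
    measurable_fun setT h -> (forall x, 0 <= h x) ->
  \int[normalR 0%R t]_z \int[normalR 0%R s]_w h (z + w)%R =
  \int[normalR 0%R u]_w h w.
Proof.
move=> t0 s0 u0 tsu mh h0.
have s_neq0 : (s != 0)%R by rewrite gt_eqF.
under eq_integral do rewrite ge0_integral_normalR_shift//.
pose F (z : R * R) := h z.2 * (shift_density1 s z.1 z.2)%:E.
have mF : measurable_fun setT F.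
  apply: emeasurable_funM.
    exact: measurableT_comp.
  by apply/measurable_EFinP; exact: measurable_shift_density1.
have F0 z : 0 <= F z by rewrite mule_ge0// lee_fin expR_ge0.
rewrite (@fubini_tonelli _ _ _ _ _ _ _ F mF F0).
have mG : measurable_fun setT (fun w => \int[normalR 0%R t]_z F (z, w)).
  exact: measurable_fun_fubini_tonelli_G.
rewrite (ge0_integral_normalR _ mG); last by move=> w; exact: integral_ge0.
rewrite (ge0_integral_normalR _ mh h0); apply: eq_integral => w _.
have mk : measurable_fun setT (fun z => (shift_density1 s z w)%:E).
  apply/measurable_EFinP.
  exact: measurableT_comp (measurable_shift_density1 s) (measurable_pair2 w).
rewrite /F/= ge0_integralZl//; last by move=> x _; rewrite lee_fin expR_ge0.
rewrite -muleA; congr (_ * _).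
rewrite ge0_integral_normalR//; last by move=> x; rewrite lee_fin expR_ge0.
rewrite -ge0_integralZr//; last 3 first.
- apply: emeasurable_funM => //; apply/measurable_EFinP; exact: measurable_normal_pdf.
- by move=> x _; rewrite mule_ge0// lee_fin ?expR_ge0 ?normal_pdf_ge0.
- by rewrite lee_fin normal_pdf_ge0.
under eq_integral do rewrite -!EFinM (normal_pdf_conv _ _ t0 s0 u0)// EFinM.
rewrite ge0_integralZl//.
- by rewrite integral_normal_pdf mule1.
- by apply/measurable_EFinP; exact: measurable_normal_pdf.
- by move=> x _; rewrite lee_fin normal_pdf_ge0.
- by rewrite lee_fin normal_pdf_ge0.
Qed.

End normal_shift.

(** * Gaussian shifts and convolutions on R^d *)

Section tuples.
Context {R : realType}.

Lemma vadd_tcons d (a b : R) (x z : d.-tuple R) :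
  vadd (tcons (a, x)) (tcons (b, z)) = tcons ((a + b)%R, vadd x z).
Proof.
apply: eq_from_tnth => i; rewrite tnth_mktuple /tcons/=.
by case: (unliftP ord0 i) => [j ->|->]; rewrite ?tnthS ?tnth0// tnth_mktuple.
Qed.

Lemma measurable_vadd_comp d dT (T : measurableType dT) (f g : T -> d.-tuple R) :
  measurable_fun setT f -> measurable_fun setT g ->
  measurable_fun setT (fun x => vadd (f x) (g x)).
Proof.
move=> mf mg.
exact: measurableT_comp measurable_vadd (measurable_fun_pair mf mg).
Qed.

Definition shift_density d (s : R) (x z : d.-tuple R) : R :=
  (\prod_(i < d) shift_density1 s (tnth x i) (tnth z i))%R.

Lemma shift_density_gt0 d (s : R) (x z : d.-tuple R) : (0 < shift_density s x z)%R.
Proof. by apply: prodr_gt0 => i _; exact: expR_gt0. Qed.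

Lemma shift_density_ge0 d (s : R) (x z : d.-tuple R) : (0 <= shift_density s x z)%R.
Proof. exact/ltW/shift_density_gt0. Qed.

Lemma shift_density_tcons d (s a b : R) (x z : d.-tuple R) :
  shift_density s (tcons (a, x)) (tcons (b, z)) =
  (shift_density1 s a b * shift_density s x z)%R.
Proof.
rewrite /shift_density big_ord_recl /tcons/= !tnth0; congr (_ * _)%R.
by apply: eq_bigr => i _; rewrite !tnthS.
Qed.

Lemma measurable_shift_density d (s : R) :
  measurable_fun setT (fun x : d.-tuple R * d.-tuple R => shift_density s x.1 x.2).
Proof.
apply: measurable_prod => i _.
apply: (@measurableT_comp _ _ _ _ _ _ (fun x : R * R => shift_density1 s x.1 x.2)
  _ (fun x : d.-tuple R * d.-tuple R => (tnth x.1 i, tnth x.2 i))).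
  exact: measurable_shift_density1.
apply: measurable_fun_pair.
  exact: measurableT_comp (measurable_tnth i) measurable_fst.
exact: measurableT_comp (measurable_tnth i) measurable_snd.
Qed.

Lemma measurable_shift_density_comp d (s : R) dT (T : measurableType dT)
    (f g : T -> d.-tuple R) :
  measurable_fun setT f -> measurable_fun setT g ->
  measurable_fun setT (fun x => shift_density s (f x) (g x)).
Proof.
move=> mf mg.
exact: measurableT_comp (measurable_shift_density s) (measurable_fun_pair mf mg).
Qed.

(** Stated apart from [integral_power_probS] so that rewriting with it does not
    unfold [gaussian]. *)
Lemma integral_gaussianS d (s : R) (h : d.+1.-tuple R -> \bar R) :
    measurable_fun setT h -> (forall x, 0 <= h x) ->
  \int[gaussian d.+1 s]_z h z =
  \int[normalR 0%R s]_a \int[gaussian d s]_z h (tcons (a, z)).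
Proof. exact: integral_power_probS. Qed.

(** The Cameron-Martin formula, coordinate by coordinate. *)
Lemma ge0_integral_gaussian_shift d (s : R) (x : d.-tuple R)
    (h : d.-tuple R -> \bar R) : (s != 0)%R ->
    measurable_fun setT h -> (forall x, 0 <= h x) ->
  \int[gaussian d s]_z h (vadd x z) =
  \int[gaussian d s]_z (h z * (shift_density s x z)%:E).
Proof.
move=> s0; elim: d x h => [|d IH] x h mh h0.
  rewrite /gaussian !integral_power_prob0//.
  - by rewrite /shift_density big_ord0 mule1 (tuple0 (vadd x _)).
  - apply: emeasurable_funM => //; apply/measurable_EFinP.
    exact: measurable_shift_density_comp.
  - by apply: measurableT_comp mh _; exact: measurable_vadd_comp.
case/tupleP: x => a x; rewrite -[ [tuple of _] ]/(tcons (a, x)).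
rewrite !integral_gaussianS//; last 3 first.
- apply: emeasurable_funM => //; apply/measurable_EFinP.
  exact: measurable_shift_density_comp.
- by move=> z; rewrite mule_ge0// lee_fin shift_density_ge0.
- by apply: measurableT_comp mh _; exact: measurable_vadd_comp.
under eq_integral do under eq_integral do rewrite vadd_tcons.
pose F (p : (R * d.-tuple R)) := h (tcons p) * (shift_density s x p.2)%:E.
have mF : measurable_fun setT F.
  apply: emeasurable_funM.
    exact: measurableT_comp mh (@measurable_tcons _ _ _).
  by apply/measurable_EFinP; exact: measurable_shift_density_comp.
have F0 p : 0 <= F p by rewrite mule_ge0// lee_fin shift_density_ge0.
pose H b := \int[gaussian d s]_z F (b, z).
have mH : measurable_fun setT H by exact: measurable_fun_fubini_tonelli_F.
have H0 b : 0 <= H b by exact: integral_ge0.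
transitivity (\int[normalR 0%R s]_b H (a + b)%R).
  apply: eq_integral => b _.
  rewrite (IH x (fun z => h (tcons ((a + b)%R, z))))//.
  apply: measurableT_comp mh _; apply: measurableT_comp (@measurable_tcons _ _ _) _.
  exact: measurable_pair1.
rewrite ge0_integral_normalR_shift//; apply: eq_integral => b _.
rewrite -ge0_integralZr//; last 2 first.
- exact: measurableT_comp mF (measurable_pair1 b).
- by rewrite lee_fin expR_ge0.
apply: eq_integral => z _.
by rewrite shift_density_tcons EFinM /F/= -!muleA; congr (_ * _); rewrite muleC.
Qed.

Lemma ge0_integral_gaussian_conv d (t s u : R) (h : d.-tuple R -> \bar R) :
    (0 < t)%R -> (0 < s)%R -> (0 < u)%R -> (t ^+ 2 + s ^+ 2 = u ^+ 2)%R ->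
    measurable_fun setT h -> (forall x, 0 <= h x) ->
  \int[gaussian d t]_z \int[gaussian d s]_w h (vadd z w) =
  \int[gaussian d u]_w h w.
Proof.
move=> t0 s0 u0 tsu; elim: d h => [|d IH] h mh h0.
  have mh2 : measurable_fun setT (fun z => \int[gaussian 0 s]_w h (vadd z w)).
    apply: (@measurable_fun_fubini_tonelli_F _ _ _ _ _ _ (fun p => h (vadd p.1 p.2))) => //.
    by apply: measurableT_comp mh _; exact: measurable_vadd_comp.
  rewrite /gaussian !integral_power_prob0//.
  - by congr h; rewrite (tuple0 (vadd _ _)).
  - by apply: measurableT_comp mh _; exact: measurable_vadd_comp.
have mh2 : measurable_fun setT (fun z => \int[gaussian d.+1 s]_w h (vadd z w)).
  apply: (@measurable_fun_fubini_tonelli_F _ _ _ _ _ _ (fun p => h (vadd p.1 p.2))) => //.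
  by apply: measurableT_comp mh _; exact: measurable_vadd_comp.
rewrite [LHS]integral_gaussianS//; last by move=> z; exact: integral_ge0.
pose H a := \int[gaussian d u]_z h (tcons (a, z)).
have mht : measurable_fun setT (h \o @tcons _ _ d).
  exact: measurableT_comp mh (@measurable_tcons _ _ _).
have mH : measurable_fun setT H.
  apply: (@measurable_fun_fubini_tonelli_F _ _ _ _ _ _ (fun p : R * d.-tuple R => h (tcons p))) => //.
have H0 b : 0 <= H b by exact: integral_ge0.
transitivity (\int[normalR 0%R u]_a H a); last exact/esym/integral_gaussianS.
rewrite -(ge0_integral_normalR_conv t0 s0 u0 tsu mH H0).
apply: eq_integral => a _.
pose F (p : (d.-tuple R * R) * d.-tuple R) := h (tcons ((a + p.1.2)%R, vadd p.1.1 p.2)).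
have mF : measurable_fun setT F.
  apply: measurableT_comp mht _; apply: measurable_fun_pair => /=.
    apply: measurable_funD => //; exact: measurableT_comp.
  apply: measurable_vadd_comp => //; exact: measurableT_comp.
have F0 p : 0 <= F p by exact: h0.
pose G (p : d.-tuple R * R) := \int[gaussian d s]_w F (p, w).
have mG : measurable_fun setT G by exact: (measurable_fun_fubini_tonelli_F F).
have G0 p : 0 <= G p by exact: integral_ge0.
transitivity (\int[gaussian d t]_z \int[normalR 0%R s]_b G (z, b)).
  apply: eq_integral => z _.
  have mhz : measurable_fun setT (fun w => h (vadd (tcons (a, z)) w)).
    by apply: measurableT_comp mh _; exact: measurable_vadd_comp.
  rewrite (integral_gaussianS _ mhz (fun w => h0 _)).
  by under eq_integral do under eq_integral do rewrite vadd_tcons.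
rewrite (fubini_tonelli G mG G0); apply: eq_integral => b _.
rewrite -[RHS]IH; [by []| |by move=> w; exact: h0].
exact: measurableT_comp mht (measurable_pair1 _).
Qed.

End tuples.

(** * Transport cost and Gaussian affinity *)

Section transport.
Context {R : realType} {d : nat}.
Implicit Types (x z : d.-tuple R) (s : R).

Lemma addr_ge_geomean (p q r : R) :
  (0 <= p -> 0 <= q -> 0 <= r -> r ^+ 2 = p * q -> 2 * r <= p + q)%R.
Proof.
move=> p0 q0 r0 rpq; rewrite -(@ler_pXn2r _ 2)// ?nnegrE ?addr_ge0 ?mulr_ge0//.
by have := sqr_ge0 (p - q)%R; nra.
Qed.

Lemma vaddA x y z : vadd (vadd x y) z = vadd x (vadd y z).
Proof. by apply: eq_from_tnth => i; rewrite !tnth_mktuple addrA. Qed.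

(** Seen from the midpoint m of x and x', the laws N(x, s^2) and N(x', s^2) have
    densities k(y, z) and k(-y, z) at m + z with respect to N(m, s^2), where
    y = (x - x') / 2, and k(y, z) * k(-y, z) does not depend on z; AM-GM applied
    to t * k(y, .) and t^-1 * k(-y, .) then bounds the integrand by a constant. *)
Lemma gaussian_affinity s x x' (t : d.-tuple R -> R) : (0 < s)%R ->
    measurable_fun setT t -> (forall x, 0 < t x)%R ->
  2%:E <= \int[gaussian d s]_z (t (vadd x z))%:E +
          \int[gaussian d s]_z ((t (vadd x' z))^-1)%:E +
          (sqdist x x' / (4 * s ^+ 2))%:E.
Proof.
move=> s0 mt t0.
pose m := [tuple ((tnth x i + tnth x' i) / 2)%R | i < d].
pose y := [tuple ((tnth x i - tnth x' i) / 2)%R | i < d].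
pose y' := [tuple (- tnth y i)%R | i < d].
have -> : x = vadd m y.
  by apply: eq_from_tnth => i; rewrite !tnth_mktuple; field.
have -> : x' = vadd m y'.
  by apply: eq_from_tnth => i; rewrite !tnth_mktuple; field.
have s_neq0 : (s != 0)%R by rewrite gt_eqF.
have mtm : measurable_fun setT (t \o vadd m).
  exact: measurableT_comp mt (measurable_vadd_comp _ _).
have mtV : measurable_fun setT (fun z => (t (vadd m z))^-1%R).
  by apply: measurable_fun_invr => [|z]; [exact: mtm|exact: t0].
under eq_integral do rewrite vaddA.
under [X in _ + X + _]eq_integral do rewrite vaddA.
rewrite (ge0_integral_gaussian_shift y s_neq0 (h := fun z => (t (vadd m z))%:E)); last 2 first.
- exact/measurable_EFinP.
- by move=> z; rewrite lee_fin ltW.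
rewrite (ge0_integral_gaussian_shift y' s_neq0 (h := fun z => ((t (vadd m z))^-1)%:E)); last 2 first.
- exact/measurable_EFinP.
- by move=> z; rewrite lee_fin invr_ge0 ltW.
set c := (_ / _)%R.
have cE : c = (\sum_(i < d) tnth y i ^+ 2 / s ^+ 2)%R.
  rewrite /c /sqdist mulr_suml; apply: eq_bigr => i _; rewrite !tnth_mktuple.
  by field.
have intc (r : R) : \int[gaussian d s]_z r%:E = r%:E by exact: integral_cst_prob.
have mk w : measurable_fun setT (shift_density s w : d.-tuple R -> R).
  exact: measurable_shift_density_comp.
have mI w (f : d.-tuple R -> R) : measurable_fun setT f ->
    measurable_fun setT (fun z => (f z)%:E * (shift_density s w z)%:E).
  by move=> mf; apply: emeasurable_funM; exact/measurable_EFinP.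
have I0 w (r : R) z : (0 < r)%R -> 0 <= r%:E * (shift_density s w z)%:E.
  by move=> r0; rewrite mule_ge0// lee_fin ?shift_density_ge0// ltW.
have tV0 z : (0 < (t (vadd m z))^-1)%R by rewrite invr_gt0.
have c0 : (0 <= c)%R by rewrite cE sumr_ge0// => i _; rewrite divr_ge0 ?sqr_ge0.
rewrite -(intc c) -[leLHS]intc -!ge0_integralD//=; last 6 first.
- by move=> z _; apply: adde_ge0; apply: I0.
- by apply: emeasurable_funD; apply: mI.
- by move=> z _; apply: I0.
- exact: mI.
- by move=> z _; apply: I0.
- exact: mI.
apply: ge0_le_integral_lower => [z|z]; first by rewrite lee_fin.
rewrite -!EFinM -!EFinD lee_fin.
(* the affinity of the two laws; its square is the product of their densities,
   whatever z is *)
pose rho := (\prod_(i < d) expR (- (tnth y i ^+ 2 / (2 * s ^+ 2))))%R.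
have rho_ge : (1 - c / 2 <= rho)%R.
  rewrite /rho -expR_sum sumrN cE.
  apply: le_trans (expR_ge1Dx _); rewrite lerD2l lerN2 mulr_suml.
  by apply: ler_sum => i _; rewrite invfM mulrA mulrAC.
suff : (2 * rho <= t (vadd m z) * shift_density s y z +
                    (t (vadd m z))^-1 * shift_density s y' z)%R.
  by lra.
apply: addr_ge_geomean.
- by rewrite mulr_ge0 ?shift_density_ge0// ltW.
- by rewrite mulr_ge0 ?shift_density_ge0// ltW.
- by apply: prodr_ge0 => i _; exact: expR_ge0.
- rewrite mulrACA divff ?gt_eqF// mul1r /rho /shift_density -!big_split/= -prodrXl.
  apply: eq_bigr => i _; rewrite /shift_density1 -expRM_natl -expRD; congr expR.
  by rewrite !tnth_mktuple; field.
Qed.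

(** Average [gaussian_affinity] over a coupling: its first two terms depend on one
    marginal each, and the third averages to the transport cost. *)
Lemma W2sq_ge_affinity s (mu nu : {measure set (d.-tuple R) -> \bar R})
    (t : d.-tuple R -> R) (r : R) : (0 < s)%R ->
    measurable_fun setT t -> (forall x, 0 < t x)%R ->
    \int[mu]_x \int[gaussian d s]_z (t (vadd x z))%:E +
    \int[nu]_x \int[gaussian d s]_z ((t (vadd x z))^-1)%:E <= r%:E ->
  (4 * s ^+ 2 * (2 - r))%:E <= W2sq mu nu.
Proof.
move=> s0 mt t0 ABr.
apply: le_ereal_inf_tmp => _ [pi cpi <-].
set I := \int[pi]_z _.
have [->|Ifin] := eqVneq I +oo; first by rewrite leey.
have sq0 (z : d.-tuple R * d.-tuple R) : (0 <= sqdist z.1 z.2)%R.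
  by apply: sumr_ge0 => i _; exact: sqr_ge0.
have I0 : 0 <= I by apply: integral_ge0 => z _; rewrite lee_fin.
have If : I \is a fin_num by rewrite ge0_fin_numE// ltey.
have mtV : measurable_fun setT (fun z => (t z)^-1%R).
  exact: measurable_fun_invr.
pose A x := \int[gaussian d s]_z (t (vadd x z))%:E.
pose B x := \int[gaussian d s]_z ((t (vadd x z))^-1)%:E.
have A0 x : 0 <= A x by apply: integral_ge0 => z _; rewrite lee_fin ltW.
have B0 x : 0 <= B x by apply: integral_ge0 => z _; rewrite lee_fin invr_ge0 ltW.
have mA : measurable_fun setT A.
  apply: (@measurable_fun_fubini_tonelli_F _ _ _ _ _ _ (fun p => (t (vadd p.1 p.2))%:E)) => //.
    by apply/measurable_EFinP; apply: measurableT_comp mt _; exact: measurable_vadd_comp.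
  by move=> p; rewrite lee_fin ltW.
have mB : measurable_fun setT B.
  apply: (@measurable_fun_fubini_tonelli_F _ _ _ _ _ _ (fun p => ((t (vadd p.1 p.2))^-1)%:E)) => //.
    apply/measurable_EFinP.
    by apply: (measurableT_comp mtV); exact: measurable_vadd_comp.
  by move=> p; rewrite lee_fin invr_ge0 ltW.
have EA : \int[pi]_z A z.1 = \int[mu]_x A x.
  transitivity (\int[pushforward pi fst]_x A x); first by rewrite ge0_integral_pushforward.
  by apply: eq_measure_integral => D mD _; have [] := cpi D mD.
have EB : \int[pi]_z B z.2 = \int[nu]_x B x.
  transitivity (\int[pushforward pi snd]_x B x); first by rewrite ge0_integral_pushforward.
  by apply: eq_measure_integral => D mD _; have [] := cpi D mD.
have msq : measurable_fun setT (fun z : d.-tuple R * d.-tuple R => sqdist z.1 z.2).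
  apply: measurable_sum => i; apply: measurable_funX; apply: measurable_funB.
    exact: measurableT_comp (measurable_tnth i) measurable_fst.
  exact: measurableT_comp (measurable_tnth i) measurable_snd.
have c0 : (0 < 4 * s ^+ 2)%R by rewrite mulr_gt0// exprn_gt0.
have : 2%:E <= \int[mu]_x A x + \int[nu]_x B x + ((4 * s ^+ 2)^-1)%:E * I.
  rewrite -EA -EB /I -ge0_integralZl//; last 3 first.
  - exact/measurable_EFinP.
  - by move=> z _; rewrite lee_fin.
  - by rewrite lee_fin invr_ge0 ltW.
  have mA1 : measurable_fun setT (fun z : d.-tuple R * d.-tuple R => A z.1).
    exact: measurableT_comp mA measurable_fst.
  have mB2 : measurable_fun setT (fun z : d.-tuple R * d.-tuple R => B z.2).
    exact: measurableT_comp mB measurable_snd.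
  rewrite -!ge0_integralD//; last 4 first.
  - by move=> z _; exact: adde_ge0.
  - exact: emeasurable_funD.
  - by move=> z _; rewrite -EFinM lee_fin mulr_ge0// invr_ge0 ltW.
  - by apply/measurable_EFinP; exact: measurable_funM.
  rewrite -[leLHS](integral_cst_prob pi).
  apply: ge0_le_integral_lower => [z|z]; first by rewrite lee_fin.
  by rewrite -EFinM mulrC; exact: gaussian_affinity.
move=> h.
have {}h := le_trans h (leeD ABr (lexx _)).
move: h; rewrite -(fineK If) -EFinM -EFinD !lee_fin => h.
by rewrite -ler_pdivlMl// lerBlDl.
Qed.

End transport.

(** * Smoothed measures: densities and the triangular divergence *)

Section lower_bound.
Context {R : realType} {d : nat}.

(** With t = 2 q / (p + q) in [W2sq_ge_affinity] the integrand t * p + t^-1 * q and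
    the triangular divergence integrand add up to p + q, whose integral is 2.
    This t agrees to first order around p = q with the exact minimizer of the
    integrand, the square root of q / p. *)
Lemma W2sq_ge_triangular (s : R) (mu nu : {measure set (d.-tuple R) -> \bar R})
    (gamma : probability (d.-tuple R) R) (p q : d.-tuple R -> R) : (0 < s)%R ->
    measurable_fun setT p -> measurable_fun setT q ->
    (forall z, 0 < p z)%R -> (forall z, 0 < q z)%R ->
    (forall h : d.-tuple R -> \bar R, measurable_fun setT h -> (forall z, 0 <= h z) ->
      \int[mu]_x \int[gaussian d s]_z h (vadd x z) = \int[gamma]_z (h z * (p z)%:E)) ->
    (forall h : d.-tuple R -> \bar R, measurable_fun setT h -> (forall z, 0 <= h z) ->
      \int[nu]_x \int[gaussian d s]_z h (vadd x z) = \int[gamma]_z (h z * (q z)%:E)) ->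
    \int[gamma]_z (p z)%:E = 1 -> \int[gamma]_z (q z)%:E = 1 ->
  (4 * s ^+ 2)%:E * \int[gamma]_z ((p z - q z) ^+ 2 / (2 * (p z + q z)))%:E <= W2sq mu nu.
Proof.
move=> s0 mp mq p0 q0 Hp Hq Ip Iq.
have pq0 z : (0 < p z + q z)%R by rewrite addr_gt0.
have mpq : measurable_fun setT (fun z => p z + q z)%R by exact: measurable_funD.
have mpqV : measurable_fun setT (fun z => (p z + q z)^-1)%R by exact: measurable_fun_invr.
pose t z := (2 * q z * (p z + q z)^-1)%R.
have t0 z : (0 < t z)%R by rewrite !mulr_gt0// invr_gt0.
have mt : measurable_fun setT t by apply: measurable_funM => //; exact: measurable_funM.
have mtV : measurable_fun setT (fun z => (t z)^-1)%R by exact: measurable_fun_invr.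
pose g z := ((p z - q z) ^+ 2 / (2 * (p z + q z)))%R.
have g0 z : (0 <= g z)%R by rewrite divr_ge0 ?sqr_ge0// mulr_ge0// ltW.
have mg : measurable_fun setT g.
  apply: measurable_funM; first by apply: measurable_funX; exact: measurable_funB.
  by apply: measurable_fun_invr => [|z]; [exact: measurable_funM|rewrite mulr_gt0].
pose e z := (t z * p z + (t z)^-1 * q z)%R.
have e0 z : (0 <= e z)%R by rewrite addr_ge0// mulr_ge0 ?invr_ge0 ?ltW.
have me : measurable_fun setT e by apply: measurable_funD; exact: measurable_funM.
set G := integral _ _ _; pose E := \int[gamma]_z (e z)%:E.
have GE : G + E = 2%:E.
  rewrite /G /E -ge0_integralD//; last 4 first.
  - by move=> z _; rewrite lee_fin g0.
  - exact/measurable_EFinP.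
  - by move=> z _; rewrite lee_fin e0.
  - exact/measurable_EFinP.
  transitivity (\int[gamma]_z ((p z)%:E + (q z)%:E)).
    apply: eq_integral => z _; rewrite -!EFinD; congr EFin.
    rewrite /e /t; field.
    by rewrite !gt_eqF.
  rewrite ge0_integralD//; last 4 first.
  - by move=> z _; rewrite lee_fin ltW.
  - exact/measurable_EFinP.
  - by move=> z _; rewrite lee_fin ltW.
  - exact/measurable_EFinP.
  by rewrite Ip Iq -EFinD.
have G0 : 0 <= G by apply: integral_ge0 => z _; rewrite lee_fin g0.
have E0 : 0 <= E by apply: integral_ge0 => z _; rewrite lee_fin e0.
have Gf : G \is a fin_num.
  by rewrite ge0_fin_numE// (@le_lt_trans _ _ 2%:E) ?ltry// -GE leeDl.
have Ef : E \is a fin_num.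
  by rewrite ge0_fin_numE// (@le_lt_trans _ _ 2%:E) ?ltry// -GE leeDr.
have -> : G = (2 - fine E)%:E.
  move: GE; rewrite -(fineK Gf) -(fineK Ef) -EFinD => -[<-].
  by rewrite addrK.
rewrite -EFinM; apply: (W2sq_ge_affinity (t := t)) => //.
rewrite (Hp (fun z => (t z)%:E)); [|exact/measurable_EFinP|by move=> z; rewrite lee_fin ltW].
rewrite (Hq (fun z => ((t z)^-1)%:E)); [|exact/measurable_EFinP|by move=> z; rewrite lee_fin invr_ge0 ltW].
rewrite fineK// /E -ge0_integralD//; last 4 first.
- by move=> z _; rewrite -EFinM lee_fin mulr_ge0// ltW.
- by apply/measurable_EFinP; exact: measurable_funM.
- by move=> z _; rewrite -EFinM lee_fin mulr_ge0 ?invr_ge0// ltW.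
- by apply/measurable_EFinP; exact: measurable_funM.
Qed.

Lemma ge0_integral_convolution (mu : {sigma_finite_measure set (d.-tuple R) -> \bar R})
    (nu : {sigma_finite_measure set (d.-tuple R) -> \bar R}) (h : d.-tuple R -> \bar R) :
    measurable_fun setT h -> (forall x, 0 <= h x) ->
  \int[convolution mu nu]_x h x = \int[mu]_x \int[nu]_z h (vadd x z).
Proof.
move=> mh h0.
have mv : measurable_fun setT (fun z : d.-tuple R * d.-tuple R => vadd z.1 z.2).
  exact: measurable_vadd.
transitivity (\int[pushforward (mu \x nu) (fun z => vadd z.1 z.2)]_x h x).
  exact: eq_measure_integral.
rewrite ge0_integral_pushforward// fubini_tonelli1//.
- exact: measurableT_comp mh mv.
- by move=> z; exact: h0.
Qed.

(** The N_t noise in the convolution and the N_s noise that is added afterwards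
    combine into N_u; the Cameron-Martin formula then exhibits the density of
    mu * N_u with respect to N_u. *)
Lemma smoothed_density (mu : {finite_measure set (d.-tuple R) -> \bar R}) (t s u : R)
    (h : d.-tuple R -> \bar R) :
    (0 < t)%R -> (0 < s)%R -> (0 < u)%R -> (t ^+ 2 + s ^+ 2 = u ^+ 2)%R ->
    measurable_fun setT h -> (forall x, 0 <= h x) ->
  \int[convolution mu (gaussian d t)]_x \int[gaussian d s]_z h (vadd x z) =
  \int[gaussian d u]_z (h z * \int[mu]_x (shift_density u x z)%:E).
Proof.
move=> t0 s0 u0 tsu mh h0.
have mh2 dT (T : measurableType dT) (f g : T -> d.-tuple R) :
    measurable_fun setT f -> measurable_fun setT g ->
    measurable_fun setT (fun x => h (vadd (f x) (g x))).
  by move=> mf mg; apply: measurableT_comp mh _; exact: measurable_vadd_comp.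
rewrite ge0_integral_convolution; last 2 first.
- apply: (@measurable_fun_fubini_tonelli_F _ _ _ _ _ _ (fun p => h (vadd p.1 p.2))) => //.
  exact: mh2.
- by move=> x; exact: integral_ge0.
pose F (p : d.-tuple R * d.-tuple R) := h p.2 * (shift_density u p.1 p.2)%:E.
have mF : measurable_fun setT F.
  apply: emeasurable_funM; first exact: measurableT_comp.
  apply/measurable_EFinP; exact: measurable_shift_density.
have F0 p : 0 <= F p by rewrite mule_ge0// lee_fin shift_density_ge0.
transitivity (\int[mu]_x \int[gaussian d u]_z F (x, z)).
  apply: eq_integral => x _.
  have u_neq0 : (u != 0)%R by rewrite gt_eqF.
  rewrite -(ge0_integral_gaussian_shift x u_neq0 mh h0).
  have mhx : measurable_fun setT (fun z => h (vadd x z)) by exact: mh2.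
  rewrite -(ge0_integral_gaussian_conv t0 s0 u0 tsu mhx (fun z => h0 (vadd x z))).
  apply: eq_integral => z _; apply: eq_integral => w _.
  by rewrite vaddA.
rewrite (fubini_tonelli F mF F0); apply: eq_integral => z _.
rewrite /F/= ge0_integralZl//.
- by apply/measurable_EFinP; exact: measurable_shift_density_comp.
- by move=> x _; rewrite lee_fin shift_density_ge0.
Qed.

End lower_bound.

(** * Moments of sums of i.i.d. bounded variables *)

Section moments.
Context {R : realType} {dT : measure_display} {T : measurableType dT}.
Variable P : probability T R.

Lemma bounded_integrable d' (T' : measurableType d') (Q : probability T' R)
    (f : T' -> R) (M : R) : measurable_fun setT f -> (forall x, `|f x| <= M)%R ->
  Q.-integrable setT (EFin \o f).
Proof.
move=> mf fM.
apply: (@le_integrable _ _ _ _ _ measurableT _ (EFin \o cst M)).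
- exact/measurable_EFinP.
- by move=> x _; rewrite /= lee_fin (le_trans (fM x))// ler_norm.
- exact: finite_measure_integrable_cst.
Qed.

Lemma integral_power_probS_bounded n (f : n.+1.-tuple T -> R) (M : R) :
    measurable_fun setT f -> (forall x, `|f x| <= M)%R ->
  \int[power_prob P n.+1]_t (f t)%:E =
  \int[P]_x \int[power_prob P n]_t (f (tcons (x, t)))%:E.
Proof.
move=> mf fM.
have mft : measurable_fun setT (f \o @tcons _ _ n).
  exact: measurableT_comp mf (@measurable_tcons _ _ _).
have ift : (P \x power_prob P n).-integrable setT (EFin \o (f \o @tcons _ _ n)).
  by apply: (@bounded_integrable _ _ _ _ M) => // x; exact: fM.
rewrite integral_pushforward//; last exact/measurable_EFinP.
by rewrite preimage_setT -fubini1.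
Qed.

Variables (g : T -> R) (C v k3 : R).
Hypotheses (mg : measurable_fun setT g) (gC : forall x, (`|g x| <= C)%R).
Hypotheses (Eg1 : \int[P]_x (g x)%:E = 0) (Eg2 : \int[P]_x (g x ^+ 2)%:E = v%:E)
  (Eg3 : \int[P]_x (g x ^+ 3)%:E = k3%:E).

Let gX_integrable k : P.-integrable setT (fun x => (g x ^+ k)%:E).
Proof.
apply: (@bounded_integrable _ _ _ _ (C ^+ k)%R); first exact: measurable_funX.
by move=> x; rewrite normrX lerXn2r// nnegrE ?normr_ge0// (le_trans _ (gC x)).
Qed.

(** The one-step computation behind the moment recursions below. *)
Lemma integral_cubic (a b c e : R) :
  \int[P]_x (a + b * g x + c * g x ^+ 2 + e * g x ^+ 3)%:E =
  (a + c * v + e * k3)%:E.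
Proof.
have iZ r k : P.-integrable setT (fun x => r%:E * (g x ^+ k)%:E).
  exact: integrableZl.
have ia : P.-integrable setT (fun _ => a%:E).
  exact: finite_measure_integrable_cst.
have g1 : P.-integrable setT (fun x => (g x)%:E) by have := gX_integrable 1.
have i1 : P.-integrable setT (fun x => b%:E * (g x)%:E) by exact: integrableZl.
have i01 := integrableD measurableT ia i1.
have i012 := integrableD measurableT i01 (iZ c 2%N).
under eq_integral do rewrite !EFinD !EFinM.
rewrite (integralD measurableT i012 (iZ e 3%N)) (integralD measurableT i01 (iZ c 2%N)).
rewrite (integralD measurableT ia i1) integral_cst_prob !integralZl//.
by rewrite Eg1 Eg2 Eg3 mule0 adde0.
Qed.

Definition sample_sum n (t : n.-tuple T) : R := (\sum_(i < n) g (tnth t i))%R.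

Lemma measurable_sample_sum n : measurable_fun setT (@sample_sum n).
Proof.
apply: measurable_sum => i; exact: measurableT_comp mg (measurable_tnth i).
Qed.

Lemma sample_sum_tcons n x (t : n.-tuple T) :
  sample_sum (tcons (x, t)) = (g x + sample_sum t)%R.
Proof.
rewrite /sample_sum big_ord_recl /tcons/= tnth0; congr (_ + _)%R.
by apply: eq_bigr => i _; rewrite tnthS.
Qed.

Lemma norm_sample_sumX_le n (a : R) k (t : n.-tuple T) :
  (`|(a + sample_sum t) ^+ k| <= (`|a| + n%:R * C) ^+ k)%R.
Proof.
have h : (`|a + sample_sum t| <= `|a| + n%:R * C)%R.
  apply: le_trans (ler_normD _ _) _; rewrite lerD2l.
  apply: le_trans (ler_norm_sum _ _ _) _.
  rewrite mulr_natl -[n in leRHS]card_ord -sumr_const.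
  by apply: ler_sum => i _; exact: gC.
by rewrite normrX lerXn2r// nnegrE ?normr_ge0// (le_trans _ h).
Qed.

Lemma measurable_sample_sumX n (a : R) k :
  measurable_fun setT (fun t : n.-tuple T => (a + sample_sum t) ^+ k)%R.
Proof.
by apply: measurable_funX; apply: measurable_funD => //; exact: measurable_sample_sum.
Qed.

(** The shift a is what makes the induction go through: conditionally on the first
    variable, the sum is the shorter sum shifted by a + g x. *)
Lemma sample_sum_moment2 n (a : R) :
  \int[power_prob P n]_t ((a + sample_sum t) ^+ 2)%:E = (a ^+ 2 + n%:R * v)%:E.
Proof.
elim: n a => [|n IH] a.
  rewrite integral_power_prob0; last first.
    by apply/measurable_EFinP; exact: measurable_sample_sumX.
  by rewrite /sample_sum big_ord0 addr0 mul0r addr0.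
rewrite (@integral_power_probS_bounded _ _ ((`|a| + n.+1%:R * C) ^+ 2)%R); last 2 first.
- exact: measurable_sample_sumX.
- by move=> t; exact: norm_sample_sumX_le.
under eq_integral => x _.
  under eq_integral do rewrite sample_sum_tcons addrA.
  rewrite IH.
  rewrite (_ : _ + _ = (a ^+ 2 + n%:R * v) + (2 * a) * g x + 1 * g x ^+ 2 + 0 * g x ^+ 3)%R; last by ring.
  over.
by rewrite integral_cubic -natr1; congr EFin; ring.
Qed.

Lemma sample_sum_moment3 n (a : R) :
  \int[power_prob P n]_t ((a + sample_sum t) ^+ 3)%:E =
  (a ^+ 3 + 3 * a * (n%:R * v) + n%:R * k3)%:E.
Proof.
elim: n a => [|n IH] a.
  rewrite integral_power_prob0; last first.
    by apply/measurable_EFinP; exact: measurable_sample_sumX.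
  by rewrite /sample_sum big_ord0 addr0 !mul0r mulr0 !addr0.
rewrite (@integral_power_probS_bounded _ _ ((`|a| + n.+1%:R * C) ^+ 3)%R); last 2 first.
- exact: measurable_sample_sumX.
- by move=> t; exact: norm_sample_sumX_le.
under eq_integral => x _.
  under eq_integral do rewrite sample_sum_tcons addrA.
  rewrite IH.
  rewrite (_ : _ + _ + _ = (a ^+ 3 + 3 * a * (n%:R * v) + n%:R * k3) +
    (3 * a ^+ 2 + 3 * (n%:R * v)) * g x + (3 * a) * g x ^+ 2 + 1 * g x ^+ 3)%R; last by ring.
  over.
by rewrite integral_cubic -natr1; congr EFin; ring.
Qed.

End moments.

Section sample_mean.
Context {R : realType} {dT : measure_display} {T : measurableType dT}.
Variable P : probability T R.

Definition sample_mean (phi : T -> R) n (t : n.-tuple T) : R :=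
  (n%:R^-1 * \sum_(i < n) phi (tnth t i))%R.

(** For y = X - m > - m, where X is the sample mean, the tangent line of the
    convex function 1 / (y + 2 m) at y = 0 gives
    y^2 / (y + 2 m) >= y^2 / (2 m) - y^3 / (4 m^2).  The expectations of y^2 and
    y^3 are v / n and k3 / n^2, and the third central moment k3 is at most C v
    since |phi - m| <= C. *)
Lemma sample_mean_triangular_ge (phi : T -> R) (C m v : R) n : (0 < n)%N ->
    measurable_fun setT phi -> (forall x, 0 < phi x <= C)%R -> (0 < m)%R ->
    \int[P]_x (phi x)%:E = m%:E -> \int[P]_x ((phi x - m) ^+ 2)%:E = v%:E ->
  (v / (2 * m) * (1 - C / (2 * m * n%:R)))%:E <=
  n%:R%:E * \int[power_prob P n]_t
    ((sample_mean phi t - m) ^+ 2 / (sample_mean phi t + m))%:E.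
Proof.
move=> n0 mphi phi0C m0 Em Ev.
have phi0 x : (0 < phi x)%R by have /andP[] := phi0C x.
have phiC x : (phi x <= C)%R by have /andP[] := phi0C x.
pose g x := (phi x - m)%R.
have mg : measurable_fun setT g by exact: measurable_funB.
have mC : (m <= C)%R.
  rewrite -lee_fin -Em -(integral_cst_prob P C).
  by apply: ge0_le_integral_lower => x; rewrite lee_fin// ltW.
have gC x : (`|g x| <= C)%R.
  by rewrite ler_norml /g; have := phi0 x; have := phiC x; lra.
have C0 : (0 < C)%R by exact: lt_le_trans mC.
have iX k : P.-integrable setT (fun x => (g x ^+ k)%:E).
  apply: (@bounded_integrable _ _ _ _ _ (C ^+ k)%R); first exact: measurable_funX.
  by move=> x; rewrite normrX lerXn2r// nnegrE ?normr_ge0// ltW.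
have Eg1 : \int[P]_x (g x)%:E = 0.
  under eq_integral do rewrite EFinB.
  rewrite integralB//.
  - by rewrite Em integral_cst_prob subee.
  - apply: (@bounded_integrable _ _ _ _ _ C) => // x; rewrite ger0_norm//; exact: ltW.
  - exact: finite_measure_integrable_cst.
pose k3 := fine (\int[P]_x (g x ^+ 3)%:E).
have Eg3 : \int[P]_x (g x ^+ 3)%:E = k3%:E.
  rewrite /k3 fineK//; exact: integrable_fin_num.
have k3v : (k3 <= C * v)%R.
  rewrite -lee_fin -Eg3 EFinM -Ev -integralZl//.
  apply: le_integral => //; first exact: integrableZl.
  move=> x _; rewrite -EFinM lee_fin exprS ler_wpM2r ?sqr_ge0//.
  exact: le_trans (ler_norm _) (gC x).
have nR : (0 < n%:R :> R)%R by rewrite ltr0n.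
have sE (t : n.-tuple T) : (sample_mean phi t - m = n%:R^-1 * sample_sum g t)%R.
  rewrite /sample_mean /sample_sum /g big_split/= sumr_const card_ord mulrDr.
  by congr (_ + _)%R; rewrite mulNrn -(mulr_natl m) mulrN mulKf ?gt_eqF.
have X0 (t : n.-tuple T) : (0 < sample_mean phi t)%R.
  rewrite mulr_gt0 ?invr_gt0// (bigD1 (Ordinal n0))//= ltr_pwDl//.
  by apply: sumr_ge0 => i _; exact: ltW.
pose L (t : n.-tuple T) := ((2 * m * n%:R)^-1 * sample_sum g t ^+ 2 -
  (4 * m ^+ 2 * n%:R ^+ 2)^-1 * sample_sum g t ^+ 3)%R.
pose G (t : n.-tuple T) :=
  (n%:R * ((sample_mean phi t - m) ^+ 2 / (sample_mean phi t + m)))%R.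
have LG t : (L t <= G t)%R.
  have := X0 t; have := sE t; rewrite /L /G.
  set X := sample_mean phi t => XE X0t.
  have -> : sample_sum g t = (n%:R * (X - m))%R by rewrite XE mulVKf ?gt_eqF.
  rewrite [leLHS](_ : _ = n%:R * ((X - m) ^+ 2 * ((2 * m - (X - m)) / (4 * m ^+ 2))))%R.
    rewrite ler_pM2l// ler_wpM2l ?sqr_ge0//.
    rewrite -[leRHS]div1r ler_pdivlMr ?addr_gt0// mulrAC ler_pdivrMr ?mulr_gt0 ?exprn_gt0//.
    by have := sqr_ge0 (X - m); nra.
  by field; rewrite !gt_eqF.
have mD k : measurable_fun setT (fun t : n.-tuple T => sample_sum g t ^+ k)%R.
  by apply: measurable_funX; exact: measurable_sample_sum.
have iD k : (power_prob P n).-integrable setT (fun t => (sample_sum g t ^+ k)%:E).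
  apply: (@bounded_integrable _ _ _ _ _ ((n%:R * C) ^+ k)%R) => // t.
  by have := norm_sample_sumX_le gC 0%R k t; rewrite add0r normr0 add0r.
have iZ r k : (power_prob P n).-integrable setT (fun t => r%:E * (sample_sum g t ^+ k)%:E).
  by apply: integrableZl => //; exact: iD.
have IL : \int[power_prob P n]_t (L t)%:E =
    ((2 * m * n%:R)^-1 * (n%:R * v) - (4 * m ^+ 2 * n%:R ^+ 2)^-1 * (n%:R * k3))%:E.
  have M2 := sample_sum_moment2 mg gC Eg1 Ev Eg3 n 0%R.
  have M3 := sample_sum_moment3 mg gC Eg1 Ev Eg3 n 0%R.
  under eq_integral do rewrite EFinB !EFinM.
  rewrite (integralB measurableT (iZ _ 2%N) (iZ _ 3%N)).
  rewrite (integralZl measurableT (iD 2%N)) (integralZl measurableT (iD 3%N)).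
  under eq_integral do rewrite -[sample_sum g _]add0r.
  rewrite M2; under eq_integral do rewrite -[sample_sum g _]add0r.
  rewrite M3 -!EFinM -EFinB; congr EFin; ring.
have mX : measurable_fun setT (fun t : n.-tuple T => sample_mean phi t).
  have -> : (fun t : n.-tuple T => sample_mean phi t) = (fun t => m + n%:R^-1 * sample_sum g t)%R.
    by apply/funext => t; rewrite -sE; ring.
  apply: measurable_funD => //; apply: measurable_funM => //.
  exact: measurable_sample_sum.
have G0 t : (0 <= G t)%R.
  by rewrite mulr_ge0 ?(ltW nR)// divr_ge0 ?sqr_ge0// addr_ge0 ?ltW.
have mQ : measurable_fun setT
    (fun t : n.-tuple T => (sample_mean phi t - m) ^+ 2 / (sample_mean phi t + m))%R.
  apply: measurable_funM.
    by apply: measurable_funX; exact: measurable_funB.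
  apply: measurable_fun_invr; first exact: measurable_funD.
  by move=> t; rewrite addr_gt0.
have iL : (power_prob P n).-integrable setT (fun t => (L t)%:E).
  by have := integrableB measurableT (iZ (2 * m * n%:R)^-1%R 2%N) (iZ (4 * m ^+ 2 * n%:R ^+ 2)^-1%R 3%N).
apply: (@le_trans _ _ (\int[power_prob P n]_t (L t)%:E)).
  rewrite IL lee_fin.
  have -> : (v / (2 * m) * (1 - C / (2 * m * n%:R)) =
    (2 * m * n%:R)^-1 * (n%:R * v) - (4 * m ^+ 2 * n%:R ^+ 2)^-1 * (n%:R * (C * v)))%R.
    by field; rewrite !gt_eqF.
  rewrite lerD2l lerN2; apply: ler_wpM2l.
    by apply/ltW; rewrite invr_gt0 !mulr_gt0 ?exprn_gt0.
  by apply: ler_wpM2l => //; exact: ltW.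
rewrite -ge0_integralZl//; last 2 first.
- exact/measurable_EFinP.
- by move=> t _; rewrite lee_fin divr_ge0 ?sqr_ge0// addr_ge0 ?ltW.
by apply: le_integral_nng => t; rewrite -EFinM lee_fin ?LG ?G0.
Qed.
End sample_mean.

(** * Chi-square divergence and Gaussian mixtures *)

Section chi2.
Context {R : realType}.

(** The density rho coincides almost everywhere with the Radon-Nikodym derivative. *)
Lemma chi2_div_density d (T : measurableType d) (mu nu : probability T R)
    (rho : T -> R) : measurable_fun setT rho ->
    (forall A, measurable A -> mu A = \int[nu]_(x in A) (rho x)%:E) ->
  chi2_div mu nu = \int[nu]_x ((rho x - 1) ^+ 2)%:E.
Proof.
move=> mrho muE.
have mrhoE : measurable_fun setT (EFin \o rho) by exact/measurable_EFinP.
have dom : mu `<< nu.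
  apply/null_content_dominatesP => A mA nuA; rewrite [LHS]muE//.
  by apply: null_set_integral => //; exact: measurable_funTS.
rewrite /chi2_div asboolT//.
have mRN : measurable_fun setT ('d (charge_of_finite_measure mu) '/d nu) by [].
have ae : ae_eq nu setT ('d (charge_of_finite_measure mu) '/d nu) (EFin \o rho).
  apply: integral_ae_eq => //; first exact: Radon_Nikodym_integrable.
  move=> A _ mA.
  by rewrite -Radon_Nikodym_integral//; exact: muE.
apply: ae_eq_integral => //.
- apply: emeasurable_funM; exact: emeasurable_funB.
- by apply/measurable_EFinP; apply: measurable_funX; exact: measurable_funB.
- apply: filterS ae => x /= h _; rewrite h//.
Qed.

End chi2.

Section mixture.
Context {R : realType} {d : nat}.
Implicit Types (P : probability (d.-tuple R) R) (s : R).

(** The maximum over x of the density [shift_density s x z], attained at x = z. *)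
Definition shift_density_bound s (z : d.-tuple R) : R :=
  (\prod_(i < d) expR (tnth z i ^+ 2 / (2 * s ^+ 2)))%R.

Lemma shift_density_le s (x z : d.-tuple R) : (0 < s)%R ->
  (shift_density s x z <= shift_density_bound s z)%R.
Proof.
move=> s0; apply: ler_prod => i _; rewrite expR_ge0/= ler_expR.
rewrite (invfM 2%R) mulrA; apply: ler_wpM2r; first by rewrite invr_ge0 sqr_ge0.
by have := sqr_ge0 (tnth x i - tnth z i)%R; lra.
Qed.

Lemma measurable_shift_density_bound s : measurable_fun setT (shift_density_bound s).
Proof.
apply: measurable_prod => i _; apply: measurableT_comp => //.
apply: measurable_funM => //; apply: measurable_funX; exact: measurable_tnth.
Qed.

(** The density of P * N_s with respect to N_s, at z. *)
Definition mixture P s (z : d.-tuple R) : R :=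
  fine (\int[P]_x (shift_density s x z)%:E).

Lemma integral_shift_density_fin P s z : (0 < s)%R ->
  \int[P]_x (shift_density s x z)%:E = (mixture P s z)%:E.
Proof.
move=> s0; rewrite /mixture fineK//.
rewrite ge0_fin_numE; last first.
  by apply: integral_ge0 => x _; rewrite lee_fin shift_density_ge0.
apply: (@le_lt_trans _ _ (shift_density_bound s z)%:E); last exact: ltry.
rewrite -(integral_cst_prob P); apply: ge0_le_integral_lower => x.
  by rewrite lee_fin shift_density_ge0.
by rewrite lee_fin shift_density_le.
Qed.

Lemma integral_gt0 d' (T : measurableType d') (Q : probability T R) (f : T -> R) :
  measurable_fun setT f -> (forall x, 0 < f x)%R -> 0 < \int[Q]_x (f x)%:E.
Proof.
move=> mf f0; rewrite lt0e integral_ge0 ?andbT; last by move=> x _; rewrite lee_fin ltW.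
apply/negP => /eqP I0.
have /(ae_eq_integral_abs Q measurableT) ae0 : \int[Q]_x `|(f x)%:E| = 0.
  by rewrite -I0; apply: eq_integral => x _; rewrite gee0_abs// lee_fin ltW.
have [|N [mN N0 sub]] := ae0; first exact/measurable_EFinP.
have NT : N = setT.
  apply/seteqP; split => // x _; apply: sub => /= /(_ Logic.I) [] fx0.
  by have := f0 x; rewrite fx0 ltxx.
by move: N0; rewrite NT [LHS]probability_setT => /eqP; rewrite onee_eq0.
Qed.

Lemma mixture_gt0 P s z : (0 < s)%R -> (0 < mixture P s z)%R.
Proof.
move=> s0; rewrite -lte_fin -integral_shift_density_fin//.
apply: integral_gt0 => [|x]; last exact: shift_density_gt0.
exact: measurable_shift_density_comp.
Qed.

Lemma measurable_mixture P s : measurable_fun setT (mixture P s).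
Proof.
apply: measurableT_comp => //.
apply: (@measurable_fun_fubini_tonelli_G _ _ _ _ _ _ (fun p => (shift_density s p.1 p.2)%:E)) => //.
  by apply/measurable_EFinP; exact: measurable_shift_density.
by move=> p; rewrite lee_fin shift_density_ge0.
Qed.

(** The variance of the density k(S, z) for S ~ P. *)
Definition mixture_var P s (z : d.-tuple R) : R :=
  fine (\int[P]_x ((shift_density s x z - mixture P s z) ^+ 2)%:E).

Lemma mixture_le P s z : (0 < s)%R -> (mixture P s z <= shift_density_bound s z)%R.
Proof.
move=> s0; rewrite -lee_fin -integral_shift_density_fin// -(integral_cst_prob P).
apply: ge0_le_integral_lower => x; first by rewrite lee_fin shift_density_ge0.
by rewrite lee_fin shift_density_le.
Qed.

Lemma integral_mixture_var P s z : (0 < s)%R ->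
  \int[P]_x ((shift_density s x z - mixture P s z) ^+ 2)%:E = (mixture_var P s z)%:E.
Proof.
move=> s0; rewrite /mixture_var fineK//.
rewrite ge0_fin_numE; last by apply: integral_ge0 => x _; rewrite lee_fin sqr_ge0.
apply: (@le_lt_trans _ _ (shift_density_bound s z ^+ 2)%:E); last exact: ltry.
rewrite -(integral_cst_prob P); apply: ge0_le_integral_lower => x.
  by rewrite lee_fin sqr_ge0.
have k0 := shift_density_gt0 s x z; have kC := shift_density_le x z s0.
have f0 := mixture_gt0 P z s0; have fC := mixture_le P z s0.
by rewrite lee_fin -real_normK ?num_real// ler_pXn2r ?nnegrE// ?ler_norml; lra.
Qed.

Lemma mixture_var_ge0 P s z : (0 <= mixture_var P s z)%R.
Proof. by apply: fine_ge0; apply: integral_ge0 => x _; rewrite lee_fin sqr_ge0. Qed.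

Lemma measurable_mixture_var P s : measurable_fun setT (mixture_var P s).
Proof.
apply: measurableT_comp => //.
apply: (@measurable_fun_fubini_tonelli_G _ _ _ _ _ _
  (fun p => ((shift_density s p.1 p.2 - mixture P s p.2) ^+ 2)%:E)) => //.
  apply/measurable_EFinP; apply: measurable_funX; apply: measurable_funB.
    exact: measurable_shift_density.
  exact: measurableT_comp (measurable_mixture P s) measurable_snd.
by move=> p; rewrite lee_fin sqr_ge0.
Qed.

End mixture.

(** * The chi-square information of the Gaussian channel *)

Section gaussian_channel.
Context {R : realType} {d : nat}.
Variables (sigma : R) (P : probability (d.-tuple R) R).
Context {dO : measure_display} {Omega : measurableType dO}.
Variables (Pr : probability Omega R) (S Z Y : {RV Pr >-> d.-tuple R}).
Hypotheses (sigma0 : (0 < sigma)%R) (hS : has_law Pr S P)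
  (hZ : has_law Pr Z (gaussian d sigma)) (hSZ : independent_RV Pr S Z)
  (hY : forall w, Y w = vadd (S w) (Z w)).
Local Notation gamma := (gaussian d sigma).
Local Notation k := (shift_density sigma).

(** (S, Z) has law P \x gamma by independence, and (S, Y) is its image under
    (x, z) |-> (x, x + z), whose second coordinate is absorbed into a density by
    the Cameron-Martin formula. *)
Lemma ge0_integral_joint_law (F : d.-tuple R * d.-tuple R -> \bar R) :
    measurable_fun setT F -> (forall p, 0 <= F p) ->
  \int[distribution Pr (RV_pair S Y)]_p F p =
  \int[P]_x \int[gamma]_y (F (x, y) * (k x y)%:E).
Proof.
move=> mF F0.
pose F' (p : d.-tuple R * d.-tuple R) := F (p.1, vadd p.1 p.2).
have mF' : measurable_fun setT F'.
  apply: measurableT_comp mF _; apply: measurable_fun_pair => //.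
  exact: measurable_vadd.
have F'0 p : 0 <= F' p by exact: F0.
rewrite ge0_integral_distribution//.
transitivity (\int[distribution Pr (RV_pair S Z)]_p F' p).
  rewrite ge0_integral_distribution//; apply: eq_integral => w _ /=.
  by rewrite /F'/= /RV_pair hY.
transitivity (\int[P \x gamma]_p F' p).
  apply: eq_measure_integral => A mA _; apply/esym/product_measure_unique => // {mA}A B mA mB.
  transitivity (distribution Pr S A * distribution Pr Z B); first exact: hSZ.
  by rewrite (hS mA) (hZ mB).
rewrite (fubini_tonelli1 F' mF' F'0); apply: eq_integral => x _.
have mFx : measurable_fun setT (fun y => F (x, y)).
  exact: measurableT_comp mF (measurable_pair1 x).
have sigma_neq0 : (sigma != 0)%R by rewrite gt_eqF.
by rewrite -(ge0_integral_gaussian_shift x sigma_neq0 mFx (fun y => F0 (x, y))).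
Qed.

Lemma ge0_integral_output_law (h : d.-tuple R -> \bar R) :
    measurable_fun setT h -> (forall y, 0 <= h y) ->
  \int[distribution Pr Y]_y h y = \int[gamma]_y (h y * (mixture P sigma y)%:E).
Proof.
move=> mh h0.
transitivity (\int[distribution Pr (RV_pair S Y)]_p h p.2).
  rewrite !ge0_integral_distribution//; exact: measurableT_comp mh measurable_snd.
rewrite ge0_integral_joint_law//; last exact: measurableT_comp mh measurable_snd.
pose G (p : d.-tuple R * d.-tuple R) := h p.2 * (k p.1 p.2)%:E.
rewrite (fubini_tonelli G).
- apply: eq_integral => y _; rewrite -integral_shift_density_fin// /G/= ge0_integralZl//.
  + by apply/measurable_EFinP; exact: measurable_shift_density_comp.
  + by move=> x _; rewrite lee_fin shift_density_ge0.
- apply: emeasurable_funM; first exact: measurableT_comp mh measurable_snd.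
  by apply/measurable_EFinP; exact: measurable_shift_density.
- by move=> p; rewrite mule_ge0// lee_fin shift_density_ge0.
Qed.

Lemma ge0_integral_prod_law (F : d.-tuple R * d.-tuple R -> \bar R) :
    measurable_fun setT F -> (forall p, 0 <= F p) ->
  \int[(distribution Pr S \x distribution Pr Y)]_p F p =
  \int[P]_x \int[gamma]_y (F (x, y) * (mixture P sigma y)%:E).
Proof.
move=> mF F0; rewrite fubini_tonelli1//.
transitivity (\int[P]_x fubini_F (distribution Pr Y) F x).
  by apply: eq_measure_integral => A mA _; exact: hS.
apply: eq_integral => x _; rewrite /fubini_F ge0_integral_output_law//.
exact: measurableT_comp mF (measurable_pair1 x).
Qed.

(** The joint law has density k(x, y) / f(y) with respect to the product of the
    marginals, and that product has density f(y) with respect to P \x gamma; hence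
    the chi-square integrand is (k / f - 1)^2 * f = (k - f)^2 / f. *)
Lemma chi2_info_gaussian :
  chi2_info Pr S Y =
  \int[gamma]_y (mixture_var P sigma y / mixture P sigma y)%:E.
Proof.
pose f := mixture P sigma.
have f0 y : (0 < f y)%R by exact: mixture_gt0.
have mf : measurable_fun setT f by exact: measurable_mixture.
have mf2 : measurable_fun setT (fun p : d.-tuple R * d.-tuple R => f p.2).
  exact: measurableT_comp mf measurable_snd.
pose rho (p : d.-tuple R * d.-tuple R) := (k p.1 p.2 / f p.2)%R.
have mrho : measurable_fun setT rho.
  apply: measurable_funM; first exact: measurable_shift_density.
  by apply: measurable_fun_invr.
have rho0 p : (0 <= rho p)%R by rewrite divr_ge0 ?shift_density_ge0// ltW.
rewrite /chi2_info (chi2_div_density mrho); last first.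
  move=> A mA.
  have mI : measurable_fun setT (EFin \o \1_A : d.-tuple R * d.-tuple R -> \bar R).
    by apply/measurable_EFinP; exact: measurable_indic.
  transitivity (\int[distribution Pr (RV_pair S Y)]_p (\1_A p)%:E).
    by rewrite integral_indic// setIT.
  rewrite ge0_integral_joint_law//.
  rewrite [RHS]integral_mkcond epatch_indic [RHS]ge0_integral_prod_law; last 2 first.
  - by apply: emeasurable_funM => //; exact/measurable_EFinP.
  - by move=> p; rewrite mule_ge0// lee_fin// rho0.
  apply: eq_integral => x _; apply: eq_integral => y _.
  by rewrite /rho/= -!EFinM [in RHS]mulrAC -/(f y) divfK ?gt_eqF// mulrC.
rewrite ge0_integral_prod_law; last 2 first.
- by apply/measurable_EFinP; apply: measurable_funX; exact: measurable_funB.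
- by move=> p; rewrite lee_fin sqr_ge0.
pose H (p : d.-tuple R * d.-tuple R) := ((rho p - 1) ^+ 2)%:E * (f p.2)%:E.
rewrite (fubini_tonelli H).
- apply: eq_integral => y _.
  under eq_integral => x _.
    rewrite /H/= /rho/= -EFinM.
    rewrite (_ : (_ * _)%R = (f y)^-1 * (k x y - f y) ^+ 2)%R; last first.
      by field; rewrite gt_eqF.
    rewrite EFinM; over.
  rewrite ge0_integralZl//; last 3 first.
  + have mky : measurable_fun setT (fun x => k x y).
      exact: measurable_shift_density_comp.
    apply/measurable_EFinP; apply: measurable_funX.
    exact: (measurable_funB mky (measurable_cst (f y))).
  + by move=> x _; rewrite lee_fin sqr_ge0.
  + by rewrite lee_fin invr_ge0 ltW.
  by rewrite integral_mixture_var// -EFinM mulrC.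
- apply: emeasurable_funM; apply/measurable_EFinP => //.
  by apply: measurable_funX; exact: measurable_funB.
- by move=> p; rewrite mule_ge0// lee_fin ?sqr_ge0// ltW.
Qed.

End gaussian_channel.

(** * Lower bound on the risk of the smoothed empirical measure *)

Section empirical_measure.
Context {R : realType} {dT : measure_display} {T : measurableType dT}.

Lemma ge0_integral_empirical n (t : n.-tuple T) (h : T -> \bar R) :
    measurable_fun setT h -> (forall x, 0 <= h x) ->
  \int[empirical t]_x h x = (n%:R^-1)%:E * \sum_(i < n) h (tnth t i).
Proof.
move=> mh h0; rewrite ge0_integral_mscale//; congr (_ * _).
rewrite ge0_integral_measure_sum//; apply: eq_bigr => i _.
by rewrite integral_dirac// diracT mul1e (tnth_nth point).
Qed.

Lemma empirical_setT n (t : n.-tuple T) : (0 < n)%N -> @empirical R _ _ _ t setT = 1.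
Proof.
move=> n0.
transitivity (\int[@empirical R _ _ _ t]_x (cst 1) x).
  by rewrite integral_cst// mul1e.
rewrite ge0_integral_empirical// sumEFin sumr_const card_ord -EFinM mulVf//.
by rewrite pnatr_eq0 -lt0n.
Qed.

Lemma empirical_fin_num n (t : n.-tuple T) : fin_num_fun (@empirical R _ _ _ t).
Proof.
case: n t => [t A mA|n t].
  by rewrite /empirical /= /mscale /= /msum big_ord0 mule0.
apply: lty_fin_num_fun.
by rewrite empirical_setT ?ltry.
Qed.

End empirical_measure.

Section total_mass.
Context {R : realType} {d : nat}.

(** Each k(x, .) is a probability density. *)
Lemma integral_smoothed_density_mass (mu : {finite_measure set (d.-tuple R) -> \bar R}) (s : R) :
  (0 < s)%R ->
  \int[gaussian d s]_z \int[mu]_x (shift_density s x z)%:E = mu setT.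
Proof.
move=> s0.
pose F (p : d.-tuple R * d.-tuple R) := (shift_density s p.1 p.2)%:E.
rewrite -(fubini_tonelli F); last 2 first.
- by apply/measurable_EFinP; exact: measurable_shift_density.
- by move=> p; rewrite lee_fin shift_density_ge0.
transitivity (\int[mu]_x (cst 1) x); last by rewrite integral_cst// mul1e.
apply: eq_integral => x _.
transitivity (\int[gaussian d s]_z cst 1 (vadd x z) : \bar R); last exact: integral_cst_prob.
rewrite ge0_integral_gaussian_shift ?gt_eqF//.
by apply: eq_integral => z _; rewrite mul1e.
Qed.

End total_mass.

Section lower_bound_empirical.
Context {R : realType} {d : nat}.
Variables (P : probability (d.-tuple R) R) (t s u : R).
Hypotheses (t0 : (0 < t)%R) (s0 : (0 < s)%R) (u0 : (0 < u)%R)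
  (tsu : (t ^+ 2 + s ^+ 2 = u ^+ 2)%R).
Local Notation gamma := (gaussian d u).
Local Notation k := (shift_density u).
Local Notation f := (mixture P u).

Definition empirical_mixture n (x : n.-tuple (d.-tuple R)) (y : d.-tuple R) : R :=
  sample_mean (fun a => shift_density u a y) x.

Lemma integral_empirical_mixture n (x : n.-tuple (d.-tuple R)) y :
  \int[empirical x]_a (k a y)%:E = (empirical_mixture x y)%:E.
Proof.
rewrite ge0_integral_empirical; last 2 first.
- by apply/measurable_EFinP; exact: measurable_shift_density_comp.
- by move=> a; rewrite lee_fin shift_density_ge0.
by rewrite sumEFin -EFinM.
Qed.

Lemma empirical_mixture_gt0 n (x : n.-tuple (d.-tuple R)) y : (0 < n)%N ->
  (0 < empirical_mixture x y)%R.
Proof.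
move=> n0; rewrite mulr_gt0 ?invr_gt0 ?ltr0n// (bigD1 (Ordinal n0))//=.
rewrite ltr_pwDl ?shift_density_gt0//.
by apply: sumr_ge0 => i _; exact: shift_density_ge0.
Qed.

Lemma measurable_empirical_mixture n :
  measurable_fun setT (fun p : n.-tuple (d.-tuple R) * d.-tuple R =>
    empirical_mixture p.1 p.2).
Proof.
apply: measurable_funM => //; apply: measurable_sum => i.
apply: measurable_shift_density_comp => //.
exact: measurableT_comp (measurable_tnth i) measurable_fst.
Qed.

Lemma measurable_empirical_mixture1 n (x : n.-tuple (d.-tuple R)) :
  measurable_fun setT (empirical_mixture x).
Proof.
apply: measurable_funM => //; apply: measurable_sum => i.
exact: measurable_shift_density_comp.
Qed.

(** [W2sq_ge_triangular] for the densities f_n and f of the two smoothed measures. *)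
Lemma W2sq_empirical_ge n (x : n.-tuple (d.-tuple R)) : (0 < n)%N ->
  (4 * s ^+ 2)%:E * \int[gamma]_y ((empirical_mixture x y - f y) ^+ 2 /
     (2 * (empirical_mixture x y + f y)))%:E <=
  W2sq (convolution (empirical x) (gaussian d t)) (convolution P (gaussian d t)).
Proof.
move=> n0.
pose fin_mixin := Measure_isFinite.Build _ _ _ (@empirical R _ _ _ x) (empirical_fin_num x).
pose em : {finite_measure set (d.-tuple R) -> \bar R} :=
  HB.pack (Measure.sort (@empirical R _ _ _ x)) fin_mixin.
have me := measurable_empirical_mixture1 x.
apply: W2sq_ge_triangular => //.
- exact: measurable_mixture.
- by move=> z; exact: empirical_mixture_gt0.
- by move=> z; exact: mixture_gt0.
- move=> h mh h0.
  rewrite [LHS](smoothed_density em t0 s0 u0 tsu mh h0).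
  by apply: eq_integral => z _; rewrite -integral_empirical_mixture.
- move=> h mh h0.
  rewrite [LHS](smoothed_density P t0 s0 u0 tsu mh h0).
  by apply: eq_integral => z _; rewrite -integral_shift_density_fin.
- under eq_integral do rewrite -integral_empirical_mixture.
  rewrite [LHS](integral_smoothed_density_mass em u0); exact: empirical_setT.
- under eq_integral do rewrite -integral_shift_density_fin//.
  rewrite [LHS](integral_smoothed_density_mass P u0); exact: probability_setT.
Qed.

(** The positive part keeps this nonnegative for small n, as monotone convergence
    requires. *)
Definition risk_lower n (y : d.-tuple R) : R :=
  (mixture_var P u y / (2 * f y) *
   Num.max 0 (1 - shift_density_bound u y / (2 * f y * n%:R)))%R.

Lemma scaled_risk_ge n : (0 < n)%N ->
  (2 * s ^+ 2)%:E * \int[gamma]_y (risk_lower n y)%:E <=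
  n%:R%:E * \int[power_prob P n]_x
    W2sq (convolution (empirical x) (gaussian d t)) (convolution P (gaussian d t)).
Proof.
move=> n0.
have f0 y : (0 < f y)%R by exact: mixture_gt0.
have mf : measurable_fun setT f by exact: measurable_mixture.
pose D (p : n.-tuple (d.-tuple R) * d.-tuple R) : R :=
  ((empirical_mixture p.1 p.2 - f p.2) ^+ 2 / (empirical_mixture p.1 p.2 + f p.2))%R.
have ef0 (p : n.-tuple (d.-tuple R) * d.-tuple R) :
    (0 < empirical_mixture p.1 p.2 + f p.2)%R.
  apply: addr_gt0 => //; exact: empirical_mixture_gt0.
have D0 p : (0 <= D p)%R by rewrite divr_ge0 ?sqr_ge0// ltW.
have mD : measurable_fun setT D.
  have mf2 : measurable_fun setT
      (fun p : n.-tuple (d.-tuple R) * d.-tuple R => f p.2).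
    exact: measurableT_comp mf measurable_snd.
  apply: measurable_funM.
    by apply: measurable_funX; apply: measurable_funB => //; exact: measurable_empirical_mixture.
  apply: measurable_fun_invr => //.
  by apply: measurable_funD => //; exact: measurable_empirical_mixture.
have s20 : (0 <= 2 * s ^+ 2)%R by rewrite mulr_ge0 ?sqr_ge0.
have n0R : (0 <= n%:R :> R)%R by [].
pose G x := \int[gamma]_y (D (x, y))%:E.
have mG : measurable_fun setT G.
  apply: (@measurable_fun_fubini_tonelli_F _ _ _ _ _ _ (EFin \o D)) => //.
  exact/measurable_EFinP.
have G0 x : 0 <= G x by apply: integral_ge0 => y _; rewrite lee_fin.
have WG x : (2 * s ^+ 2)%:E * G x <=
    W2sq (convolution (empirical x) (gaussian d t)) (convolution P (gaussian d t)).
  apply: le_trans (W2sq_empirical_ge x n0).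
  rewrite (_ : 4 * s ^+ 2 = 2 * s ^+ 2 * 2)%R; last by ring.
  rewrite [in leRHS]EFinM -muleA lee_wpmul2l// -ge0_integralZl//; last 2 first.
  - apply/measurable_EFinP; apply: measurable_funM.
      by apply: measurable_funX; apply: measurable_funB => //; exact: measurable_empirical_mixture1.
    apply: measurable_fun_invr => [|y]; last by rewrite mulr_gt0// (ef0 (x, y)).
    apply: measurable_funM => //; apply: measurable_funD => //.
    exact: measurable_empirical_mixture1.
  - by move=> y _; rewrite lee_fin divr_ge0 ?sqr_ge0// mulr_ge0// ltW// (ef0 (x, y)).
  rewrite le_eqVlt; apply/orP; left; apply/eqP; apply: eq_integral => y _.
  rewrite -EFinM /D/=; congr EFin; field.
  by rewrite gt_eqF// (ef0 (x, y)).
apply: (@le_trans _ _ (n%:R%:E * \int[power_prob P n]_x ((2 * s ^+ 2)%:E * G x))); last first.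
  apply: lee_wpmul2l; first by rewrite lee_fin.
  by apply: ge0_le_integral_lower => // x; rewrite mule_ge0.
rewrite ge0_integralZl// muleCA lee_wpmul2l//.
rewrite [X in _ * X](fubini_tonelli (EFin \o D)); last 2 first.
- exact/measurable_EFinP.
- by move=> p; rewrite /= lee_fin.
rewrite -ge0_integralZl//; last 2 first.
- apply: (@measurable_fun_fubini_tonelli_G _ _ _ _ _ _ (EFin \o D)) => //.
  exact/measurable_EFinP.
- by move=> y _; apply: integral_ge0 => x _; rewrite /= lee_fin.
apply: ge0_le_integral_lower => y.
  rewrite lee_fin mulr_ge0 ?le_max ?lexx// divr_ge0 ?mixture_var_ge0// mulr_ge0// ltW//.
rewrite /risk_lower; case: (leP 0%R (1 - shift_density_bound u y / (2 * f y * n%:R))%R) => h.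
  apply: (@sample_mean_triangular_ge _ _ _ P (fun a => k a y)) => //.
  - exact: measurable_shift_density_comp.
  - by move=> x; rewrite shift_density_gt0 shift_density_le.
  - exact: integral_shift_density_fin.
  - exact: integral_mixture_var.
by rewrite mulr0 mule_ge0// integral_ge0// => x _; rewrite /= lee_fin.
Qed.

End lower_bound_empirical.

(** * Limit of the lower bound *)

Section divergence.
Context {R : realType} {d : nat}.

(** The index is shifted because at n = 0 the subtracted term is 0 by the
    convention 0^-1 = 0, which breaks monotonicity. *)
Lemma cvg_integral_risk_lower (P : probability (d.-tuple R) R) (u : R) : (0 < u)%R ->
  \int[gaussian d u]_y (risk_lower P u n.+1 y)%:E @[n --> \oo] -->
  (2^-1)%:E * \int[gaussian d u]_y (mixture_var P u y / mixture P u y)%:E.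
Proof.
move=> u0.
have f0 y : (0 < mixture P u y)%R by exact: mixture_gt0.
have mf : measurable_fun setT (mixture P u) by exact: measurable_mixture.
have mv : measurable_fun setT (mixture_var P u) by exact: measurable_mixture_var.
have v0 y : (0 <= mixture_var P u y)%R by exact: mixture_var_ge0.
have C0 (y : d.-tuple R) : (0 <= shift_density_bound u y)%R.
  by apply: le_trans (mixture_le P y u0); exact: ltW.
have vf0 y : (0 <= mixture_var P u y / (2 * mixture P u y))%R.
  by rewrite divr_ge0// mulr_ge0// ltW.
have mr n : measurable_fun setT (risk_lower P u n.+1).
  apply: measurable_funM.
    apply: measurable_funM => //; apply: measurable_fun_invr => [|y].
      exact: measurable_funM.
    by rewrite mulr_gt0.
  apply: measurable_maxr => //; apply: measurable_funB => //.
  apply: measurable_funM; first exact: measurable_shift_density_bound.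
  apply: measurable_fun_invr => [|y].
    by apply: measurable_funM => //; exact: measurable_funM.
  by rewrite !mulr_gt0.
have lim y : (risk_lower P u n.+1 y)%:E @[n --> \oo] -->
    (mixture_var P u y / (2 * mixture P u y))%:E.
  apply/fine_cvgP; split; first exact: nearW.
  rewrite -[X in _ --> X]mulr1; apply: cvgMl_tmp.
  set c := (shift_density_bound u y / (2 * mixture P u y))%R.
  have cvg1 : (1 - c * harmonic n)%R @[n --> \oo] --> (1:R)%R.
    rewrite -[X in _ --> X]subr0; apply: cvgB; first exact: cvg_cst.
    rewrite -(mulr0 c); apply: cvgMl_tmp; exact: cvg_harmonic.
  apply: squeeze_cvgr; [|exact: cvg1|exact: cvg_cst].
  apply: nearW => n /=; rewrite invfM mulrA -/c.
  rewrite le_max lexx orbT/= ge_max ler01/= gerBl mulr_ge0// ?invr_ge0//.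
  by rewrite divr_ge0// mulr_ge0// ltW.
have -> : (2^-1)%:E * \int[gaussian d u]_y (mixture_var P u y / mixture P u y)%:E =
    \int[gaussian d u]_y (limn (fun n => (risk_lower P u n.+1 y)%:E)).
  rewrite -ge0_integralZl//; last 2 first.
  - apply/measurable_EFinP; apply: measurable_funM => //; exact: measurable_fun_invr.
  - by move=> y _; rewrite lee_fin divr_ge0// ltW.
  apply: eq_integral => y _; rewrite (cvg_lim _ (lim y))//.
  by rewrite -EFinM invfM mulrCA.
apply: cvg_monotone_convergence => //.
- by move=> n; exact/measurable_EFinP.
- by move=> n y _; rewrite lee_fin mulr_ge0// le_max lexx.
- move=> y _ n m nm; rewrite lee_fin ler_wpM2l//.
  rewrite ge_max !le_max lexx/= lerD2l lerN2; apply/orP; right.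
  apply: ler_wpM2l => //; rewrite lef_pV2 ?posrE ?mulr_gt0// ler_pM2l ?mulr_gt0//.
  by rewrite ler_nat ltnS.
Qed.

End divergence.

Local Open Scope ring_scope.

Theorem corollary2 (R : realType) (d : nat) (hd : (1 <= d)%N)
    (sigma : R) (hsigma : 0 < sigma) (P : probability (d.-tuple R) R)
    (dO : measure_display) (Omega : measurableType dO) (Pr : probability Omega R)
    (S Z Y : {RV Pr >-> d.-tuple R})
    (hS : has_law Pr S P) (hZ : has_law Pr Z (gaussian d sigma))
    (hSZ : independent_RV Pr S Z) (hY : forall w, Y w = vadd (S w) (Z w)) :
  chi2_info Pr S Y = +oo%E ->
  forall tau : R, 0 < tau -> tau < sigma ->
    is_omega_inv (fun n : nat =>
      (\int[power_prob P n]_s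
         W2sq (convolution (empirical s) (gaussian d tau)) (convolution P (gaussian d tau)))%E).
Proof.
move=> chi2_infty tau tau0 tau_sigma.
pose s := Num.sqrt (sigma ^+ 2 - tau ^+ 2).
have s2 : 0 < sigma ^+ 2 - tau ^+ 2 by rewrite subr_gt0 ltr_pXn2r// ?nnegrE ltW.
have s0 : 0 < s by rewrite sqrtr_gt0.
have tsu : tau ^+ 2 + s ^+ 2 = sigma ^+ 2 by rewrite sqr_sqrtr ?ltW//; ring.
rewrite /is_omega_inv -cvg_shiftS.
apply: (gee_cvgy (nearW _ (fun n => scaled_risk_ge P tau0 s0 hsigma tsu (ltn0Sn n)))).
rewrite -(@gt0_muley _ (2 * s ^+ 2)%:E); last by rewrite lte_fin mulr_gt0// exprn_gt0.
apply: cvgeZl => //.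
have := cvg_integral_risk_lower (P := P) hsigma.
rewrite -(chi2_info_gaussian hsigma hS hZ hSZ hY) chi2_infty gt0_muley//.
Qed.
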